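(* Let $\Lambda$ be a lattice with basis $e_1,\dots,e_n$, let $p(t)=1+\sum_{i\ge1}a_it^i\in\mathbb{Q}[[t]]$ with $a_1\neq0$, and let $f,g$ be polynomials on $\Lambda$. The following are equivalent: (1) The map $\varphi_p$ descends to an isomorphism $\mathbb{Q}K_f\cong\mathbb{Q}A_g$. (2) There exists $\mathrm{td}_p\in(\mathbb{Q}A_g)^\times$ such that $\chi_f(E)=\deg_g(\mathrm{td}_p\cdot\varphi_p(E))$ holds for all $E\in\mathrm{Sh}(\Lambda)$. (3) There exists $\mathrm{td}_p\in(\mathbb{Q}A_g)^\times$ such that $f=\Psi_p(\mathrm{td}_p\cdot g)$. (4) $f$ is differentially equivalent to $\Psi_p(g)$.
   Context: A lattice $\Lambda$ is a free abelian group of finite rank; $P(\Lambda)$ is the ring of polynomial functions $\Lambda\to\mathbb{Q}$ with rational coefficients (''polynomials on $\Lambda$''). $\mathrm{Sh}(\Lambda)=\mathbb{Z}[\Lambda]$ is the group ring with basis $T^u$, acting on functions by $(T^uh)(x)=h(x+u)$. $\mathrm{Diff}(\Lambda)=\mathbb{Z}[\partial_{e_1},\dots,\partial_{e_n}]$ is the ring of differential operators with constant integer coefficients acting on $P(\Lambda)$, $\partial_{e_i}$ being the directional derivative along $e_i$; $\mathrm{Diff}_{\mathbb{Q}}[[\Lambda]]\cong\mathbb{Q}[[\partial_{e_1},\dots,\partial_{e_n}]]$ is its formal completion over $\mathbb{Q}$, which also acts on $P(\Lambda)$. $\mathbb{Q}R=\mathbb{Q}\otimes_{\mathbb{Z}}R$,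 $\mathrm{Sh}_{\mathbb{Q}}(\Lambda)=\mathbb{Q}\,\mathrm{Sh}(\Lambda)$. $K_f=\mathrm{Sh}(\Lambda)/\mathrm{Ann}(f)$, $A_g=\mathrm{Diff}(\Lambda)/\mathrm{Ann}(g)$ ($\mathrm{Ann}$: ideal of operators killing the polynomial); $\chi_f(E)=(E\cdot f)(0)$, $\deg_g([D])=(D\cdot g)(0)$, and $[D]\cdot g:=D\cdot g$ for $[D]\in\mathbb{Q}A_g$. $\varphi_p\colon\mathrm{Sh}_{\mathbb{Q}}(\Lambda)\to\mathrm{Diff}_{\mathbb{Q}}[[\Lambda]]$ is the $\mathbb{Q}$-algebra homomorphism with $T^{e_i}\mapsto p(\partial_{e_i})$; composing with the natural map $\mathrm{Diff}_{\mathbb{Q}}[[\Lambda]]\to\mathbb{Q}A_g$ (well defined since high-order operators kill $g$) one views it also as a map to $\mathbb{Q}A_g$, and ''descends to an isomorphism $\mathbb{Q}K_f\cong\mathbb{Q}A_g$'' means this map factors through $\mathbb{Q}K_f$ inducing an isomorphism. $\Psi_p\colon P(\Lambda)\to P(\Lambda)$ is the linear map defined by $\Psi_p(h)(u)=(\varphi_p(T^u)\cdot h)(0)$ for $u\in\Lambda$. Two polynomials $f,h$ on $\Lambda$ are differentially equivalent if $\mathrm{Ann}_{\mathrm{Diff}(\Lambda)}(f)=\mathrm{Ann}_{\mathrm{Diff}(\Lambda)}(h)$; equivalently, $f=\alpha\cdot h$ for some $\alpha\in(\mathbb{Q}A_h)^\times$. *)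

(* Defs.v *)
From HB Require Import structures.
From mathcomp Require Import all_boot all_order all_algebra.
From mathcomp Require Import boolp.
From mathcomp Require Import ring ssrcomplements.
From mathcomp Require Export freeg mpoly.

Set Implicit Arguments.
Unset Strict Implicit.
Unset Printing Implicit Defensive.

Import GRing.Theory Num.Theory.
Local Open Scope ring_scope.
Local Open Scope quotient_scope.

(* [monalg]'s monoid algebras do not cover Z[L]: its monoids have no nontrivial
   units. *)
Definition grpring (R : comNzRingType) (L : zmodType) : Type := {freeg L / R}.

HB.instance Definition _ (R : comNzRingType) (L : zmodType) :=
  GRing.Lmodule.copy (grpring R L) {freeg L / R}.

Section GroupRing.
Variables (R : comNzRingType) (L : zmodType).
Implicit Types (D E F : grpring R L) (u v : L).

Definition translation u : grpring R L := << 1 *g u >>.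

Definition grpring_mul D E : grpring R L :=
  \sum_(u <- dom D) \sum_(v <- dom E) << coeff u D * coeff v E *g u + v >>.

Lemma scale_grpU a b u : a *: << b *g u >> = << a * b *g u >> :> grpring R L.
Proof. by apply/eqP/freeg_eqP => x; rewrite coeffZ !coeffU mulrA. Qed.

Section Lift.
Variables (M : lmodType R) (f : L -> M).

Definition grp_lift D : M := \sum_(u <- dom D) coeff u D *: f u.

Let ad : {additive {freeg L / R} -> M} :=
  HB.pack (fglift f) (GRing.isZmodMorphism.Build _ _ _ (lift_is_additive f)).

Lemma grp_liftE D : grp_lift D = fglift f D.
Proof.
rewrite -[in RHS](freeg_sumE D) [RHS](raddf_sum ad) /=.
by apply: eq_bigr => u _; rewrite liftU.
Qed.

Lemma grp_liftU a u : grp_lift << a *g u >> = a *: f u.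
Proof. by rewrite grp_liftE liftU. Qed.

Lemma grp_lift_is_linear : linear grp_lift.
Proof.
have addL D E : grp_lift (D + E) = grp_lift D + grp_lift E.
  by rewrite !grp_liftE; exact: (raddfD ad).
have lift0 : grp_lift 0 = 0 by rewrite grp_liftE; exact: (raddf0 ad).
move=> a D E; rewrite addL; congr (_ + _).
elim/freeg_ind_dom0: D => [|b u D _ _ IH]; first by rewrite scaler0 lift0 scaler0.
rewrite scalerDr !addL scalerDr IH; congr (_ + _).
by rewrite scale_grpU !grp_liftU scalerA.
Qed.
HB.instance Definition _ := GRing.isLinear.Build R (grpring R L) M _ grp_lift
  grp_lift_is_linear.

End Lift.

Lemma grp_ind (P : grpring R L -> Prop) :
  P 0 -> (forall a u, P << a *g u >>) -> (forall D E, P D -> P E -> P (D + E)) ->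
  forall D, P D.
Proof.
move=> P0 PU PD; elim/freeg_ind_dom0 => // a u D _ _ PDD.
exact: PD (PU _ _) PDD.
Qed.

Lemma grpring_mulE D E :
  grpring_mul D E = grp_lift (fun u => grp_lift (fun v => translation (u + v)) E) D.
Proof.
apply: eq_bigr => u _; rewrite scaler_sumr; apply: eq_bigr => v _.
by rewrite !scale_grpU mulr1.
Qed.

Lemma grpring_mulDl : left_distributive grpring_mul +%R.
Proof. by move=> D E F; rewrite !grpring_mulE linearD. Qed.

Lemma grpring_mulUU a b u v :
  grpring_mul << a *g u >> << b *g v >> = << a * b *g u + v >>.
Proof. by rewrite grpring_mulE !grp_liftU !scale_grpU mulr1. Qed.

Lemma grpring_mulC : commutative grpring_mul.
Proof.
move=> D E; rewrite /grpring_mul exchange_big; apply: eq_bigr => u _.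
by apply: eq_bigr => v _; rewrite mulrC addrC.
Qed.

Lemma grpring_mulDr : right_distributive grpring_mul +%R.
Proof. by move=> D E F; rewrite grpring_mulC grpring_mulDl !(grpring_mulC D). Qed.

Lemma grpring_mul0 : left_zero 0 grpring_mul.
Proof. by move=> D; rewrite grpring_mulE linear0. Qed.

Lemma grpring_mul0r : right_zero 0 grpring_mul.
Proof. by move=> D; rewrite grpring_mulC grpring_mul0. Qed.

Lemma grpring_mulA : associative grpring_mul.
Proof.
elim/grp_ind => [|a u|D D' IH IH'] E F; first by rewrite !grpring_mul0.
- elim/grp_ind: E => [|b v|E E' IH IH']; first by rewrite grpring_mul0 grpring_mul0r grpring_mul0.
  + elim/grp_ind: F => [|c w|F F' IH IH']; first by rewrite !grpring_mul0r.
      by rewrite !grpring_mulUU mulrA addrA.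
    by rewrite !grpring_mulDr IH IH'.
  + by rewrite !(grpring_mulDr, grpring_mulDl) IH IH'.
- by rewrite !grpring_mulDl IH IH'.
Qed.

Lemma grpring_mul1 : left_id (translation 0) grpring_mul.
Proof.
elim/grp_ind => [|a u|D E IH IH']; first exact: grpring_mul0r.
  by rewrite grpring_mulUU mul1r add0r.
by rewrite grpring_mulDr IH IH'.
Qed.

Lemma grpring_1_neq0 : translation 0 != 0.
Proof. by rewrite freegU_eq0 oner_neq0. Qed.

HB.instance Definition _ := GRing.Zmodule_isComNzRing.Build (grpring R L)
  grpring_mulA grpring_mulC grpring_mul1 grpring_mulDl grpring_1_neq0.

Lemma translationD u v : translation (u + v) = translation u * translation v.
Proof. by rewrite [RHS]grpring_mulUU mulr1. Qed.

Lemma grp_lift_mul (A : comAlgType R) (f : L -> A) :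
  {morph f : u v / u + v >-> u * v} -> {morph grp_lift f : D E / D * E}.
Proof.
move=> fD D E; elim/grp_ind: D => [|a u|D D' IH IH'].
- by rewrite mul0r linear0 mul0r.
- elim/grp_ind: E => [|b v|E E' IH IH'].
  + by rewrite mulr0 linear0 mulr0.
  + rewrite [_ * _]grpring_mulUU !grp_liftU fD.
    by rewrite -scalerAl -scalerAr scalerA.
  + by rewrite mulrDr !linearD /= mulrDr IH IH'.
- by rewrite mulrDl !linearD /= mulrDl IH IH'.
Qed.

End GroupRing.

Notation Sh := (grpring int).
Notation ShQ := (grpring rat).

Definition ShQ_of_Sh (L : zmodType) (E : Sh L) : ShQ L :=
  \sum_(u <- dom E) << (coeff u E)%:~R *g u >>.

(* [ring_quotient] only quotients by proper ideals, whereas the annihilator of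
   the zero polynomial is the whole ring. *)
Record ideal (R : comNzRingType) := Ideal {
  ideal_mem :> {pred R};
  ideal_zmod_closed : zmod_closed ideal_mem;
  ideal_absorb : forall a x, x \in ideal_mem -> a * x \in ideal_mem }.

HB.instance Definition _ (R : comNzRingType) (I : ideal R) :=
  GRing.isZmodClosed.Build R (ideal_mem I) (ideal_zmod_closed I).

Definition quot_ring (R : comNzRingType) (I : ideal R) : Type :=
  Quotient.quot (ideal_mem I).

HB.instance Definition _ (R : comNzRingType) (I : ideal R) :=
  GRing.Zmodule.copy (quot_ring I) (Quotient.quot (ideal_mem I)).

Section QuotientRing.
Variables (R : comNzRingType) (I : ideal R).

Definition quot_proj (x : R) : quot_ring I := \pi_(Quotient.quot (ideal_mem I)) x.
Definition quot_repr (x : quot_ring I) : R := repr (x : Quotient.quot (ideal_mem I)).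
Definition quot_one : quot_ring I := quot_proj 1.
Definition quot_mul (x y : quot_ring I) : quot_ring I :=
  quot_proj (quot_repr x * quot_repr y).

Lemma quot_reprK : cancel quot_repr quot_proj.
Proof. by move=> x; rewrite /quot_proj /quot_repr reprK. Qed.

Lemma quot_projP x y : quot_proj x = quot_proj y <-> x - y \in ideal_mem I.
Proof. by rewrite Quotient.idealrBE; split=> /eqP. Qed.

Lemma quot_repr_proj x : quot_repr (quot_proj x) - x \in ideal_mem I.
Proof. by apply/quot_projP; rewrite quot_reprK. Qed.

Lemma quot_projM x y : quot_proj (x * y) = quot_mul (quot_proj x) (quot_proj y).
Proof.
apply/esym/quot_projP; set a := quot_repr _; set b := quot_repr _.
have -> : a * b - x * y = a * (b - y) + y * (a - x) by ring.
by apply: rpredD; apply: ideal_absorb; apply: quot_repr_proj.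
Qed.

Lemma quot_projB : zmod_morphism quot_proj.
Proof. exact: raddfB. Qed.

Lemma quot_projD x y : quot_proj (x + y) = quot_proj x + quot_proj y.
Proof. exact: raddfD. Qed.

Fact quot_mulA : associative quot_mul.
Proof.
move=> x y z; rewrite -[x]quot_reprK -[y]quot_reprK -[z]quot_reprK.
by rewrite -!quot_projM mulrA.
Qed.

Fact quot_mulC : commutative quot_mul.
Proof. by move=> x y; rewrite /quot_mul mulrC. Qed.

Fact quot_mul1 : left_id quot_one quot_mul.
Proof. by move=> x; rewrite -[x]quot_reprK -quot_projM mul1r. Qed.

Fact quot_mulDl : left_distributive quot_mul +%R.
Proof.
move=> x y z; rewrite -[x]quot_reprK -[y]quot_reprK -[z]quot_reprK.
by rewrite -quot_projD -!quot_projM mulrDl quot_projD.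
Qed.

HB.instance Definition _ := GRing.Zmodule_isComPzRing.Build (quot_ring I)
  quot_mulA quot_mulC quot_mul1 quot_mulDl.

HB.instance Definition _ := GRing.isZmodMorphism.Build R (quot_ring I) quot_proj
  quot_projB.
HB.instance Definition _ := GRing.isMonoidMorphism.Build R (quot_ring I) quot_proj
  (erefl, quot_projM).

End QuotientRing.

(* The ideal of R generated by the image of I. *)
Definition extend_mem (R0 R : comNzRingType) (i : R0 -> R) (I : ideal R0) :
    {pred R} :=
  fun x => `[< exists s : seq (R * R0),
    all (fun cy => cy.2 \in ideal_mem I) s /\ x = \sum_(cy <- s) cy.1 * i cy.2 >].

(* [GRing.unit] is not available: the quotient may be the zero ring. *)
Definition is_invertible (R : comPzRingType) (x : R) : Prop :=
  exists y, x * y = 1.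

Section Extension.
Variables (R0 R : comNzRingType) (i : R0 -> R) (I : ideal R0).

Fact extend_zmod_closed : zmod_closed (extend_mem i I).
Proof.
split; first by apply/asboolP; exists [::]; rewrite big_nil.
move=> _ _ /asboolP [s [hs ->]] /asboolP [t [ht ->]]; apply/asboolP.
exists (s ++ [seq (- cy.1, cy.2) | cy <- t]); split.
  by rewrite all_cat hs all_map.
rewrite big_cat big_map -sumrN; congr (_ + _).
by apply: eq_bigr => cy _; rewrite mulNr.
Qed.

Fact extend_absorb a x : x \in extend_mem i I -> a * x \in extend_mem i I.
Proof.
move=> /asboolP [s [hs ->]]; apply/asboolP.
exists [seq (a * cy.1, cy.2) | cy <- s]; split; first by rewrite all_map.
by rewrite big_map mulr_sumr; apply: eq_bigr => cy _; rewrite mulrA.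
Qed.

Definition extend_ideal : ideal R := Ideal extend_zmod_closed extend_absorb.
End Extension.

Record lattice_basis (n : nat) (L : zmodType) := LatticeBasis {
  basis_vec :> 'I_n -> L;
  basis_vecP : forall x : L,
    exists! c : {ffun 'I_n -> int}, x = \sum_(i < n) basis_vec i *~ c i }.

Section Lattice.
Variables (n : nat) (L : zmodType) (e : lattice_basis n L).

Definition coord (x : L) : {ffun 'I_n -> int} := projT1 (cid (basis_vecP e x)).

Definition qcoord (x : L) (i : 'I_n) : rat := (coord x i)%:~R.

Lemma coordP x : x = \sum_(i < n) e i *~ coord x i.
Proof. by rewrite /coord; case: cid => c []. Qed.

Lemma coord_sum (c : {ffun 'I_n -> int}) : coord (\sum_(i < n) e i *~ c i) = c.
Proof.
have [d [_ dU]] := basis_vecP e (\sum_(i < n) e i *~ c i).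
exact: etrans (esym (dU _ (coordP _))) (dU _ erefl).
Qed.

Lemma coordD x y : coord (x + y) = [ffun i => coord x i + coord y i].
Proof.
rewrite {1}[x]coordP {1}[y]coordP -big_split /= -[RHS]coord_sum; congr coord.
by apply: eq_bigr => i _; rewrite ffunE mulrzDr.
Qed.

Lemma coord0 : coord 0 = [ffun=> 0].
Proof.
rewrite -[RHS]coord_sum; congr coord; apply/esym/big1 => i _.
by rewrite ffunE mulr0z.
Qed.

Lemma coord_basis i : coord (e i) = [ffun j => (j == i)%:Z].
Proof.
rewrite -[RHS]coord_sum; congr coord; rewrite (bigD1 i) //= ffunE eqxx mulr1z.
rewrite big1 ?addr0 // => j /negPf nij; by rewrite ffunE nij mulr0z.
Qed.

Definition is_polyfun (h : L -> rat) : Prop :=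
  exists q : {mpoly rat[n]}, forall x, h x = q.@[qcoord x].

Record polyfun := PolyFun { pf_fun :> L -> rat; pf_funP : is_polyfun pf_fun }.

(* The polynomial in the coordinates that represents h; it is unique
   ([polyfun_ofK]). *)
Definition pf_rep (h : polyfun) : {mpoly rat[n]} := projT1 (cid (pf_funP h)).

Definition polyfun_of (q : {mpoly rat[n]}) : polyfun :=
  @PolyFun (fun x => q.@[qcoord x]) (ex_intro _ q (fun=> erefl)).

End Lattice.

(* In [D : {mpoly R[n]}] the variable 'X_i stands for the derivative along the
   i-th basis vector. *)
Definition mdiff n (D q : {mpoly rat[n]}) : {mpoly rat[n]} :=
  \sum_(m <- msupp D) D@_m *: q^`M[m].

Section MDiff.
Variable n : nat.
Implicit Types (D E p q : {mpoly rat[n]}).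

Lemma mdiffwE k D q : (msize D <= k)%N ->
  mdiff D q = \sum_(m : 'X_{1..n < k}) D@_m *: q^`M[m].
Proof.
move=> leD; pose P (m : 'X_{1..n < k}) := (val m) \in msupp D.
rewrite (bigID P) {}/P /= addrC big1 ?add0r; last first.
  by move=> m /memN_msupp_eq0 ->; rewrite scale0r.
rewrite /mdiff (big_mksub 'X_{1..n < k}) //=; first exact/msupp_uniq.
by move=> m /msize_mdeg_lt /leq_trans; apply.
Qed.

Lemma mdiffDl D E q : mdiff (D + E) q = mdiff D q + mdiff E q.
Proof.
pose k := maxn (maxn (msize D) (msize E)) (msize (D + E)).
have [kD kE kDE] : [/\ msize D <= k, msize E <= k & msize (D + E) <= k]%N.
  by split; rewrite !leq_max leqnn ?orbT.
rewrite (mdiffwE _ kD) (mdiffwE _ kE) (mdiffwE _ kDE).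
by rewrite -big_split /=; apply: eq_bigr => m _; rewrite mcoeffD scalerDl.
Qed.

Lemma mdiffZl c D q : mdiff (c *: D) q = c *: mdiff D q.
Proof.
rewrite !(@mdiffwE (msize D)) ?msizeZ_le // scaler_sumr.
by apply: eq_bigr => m _; rewrite mcoeffZ scalerA.
Qed.

Lemma mdiff0l q : mdiff 0 q = 0.
Proof. by rewrite /mdiff msupp0 big_nil. Qed.

Lemma mdiffX m q : mdiff 'X_[m] q = q^`M[m].
Proof. by rewrite /mdiff msuppX big_seq1 mcoeffX eqxx scale1r. Qed.

Lemma mdiff_is_linear D : linear (mdiff D).
Proof.
move=> c p q; rewrite /mdiff scaler_sumr -big_split /=; apply: eq_bigr => m _.
by rewrite linearP scalerDr !scalerA mulrC.
Qed.
HB.instance Definition _ D :=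
  GRing.isLinear.Build rat {mpoly rat[n]} {mpoly rat[n]} _ (mdiff D)
    (mdiff_is_linear D).

Lemma mdiffM D E q : mdiff (D * E) q = mdiff D (mdiff E q).
Proof.
elim/mpolyind: D => [|c m D _ _ IH]; first by rewrite mul0r !mdiff0l.
rewrite mulrDl !mdiffDl IH -scalerAl !mdiffZl mdiffX; congr (_ *: _ + _).
elim/mpolyind: E {IH} => [|d m' E _ _ IH']; first by rewrite mulr0 !mdiff0l linear0.
rewrite mulrDr !mdiffDl IH' -scalerAr !mdiffZl linearD linearZ /=.
by rewrite -mpolyXD !mdiffX addmC mderivmDm.
Qed.

Lemma mdiff1 q : mdiff 1 q = q.
Proof. by rewrite -mpolyX0 mdiffX mderivm0m. Qed.

(* Restriction of q to the line through v in the i-th direction. *)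
Definition line_poly (i : 'I_n) (v : 'I_n -> rat) (q : {mpoly rat[n]}) : {poly rat} :=
  mmap polyC (fun j => (v j)%:P + (j == i)%:R *: 'X) q.

Lemma line_polyE i v q t :
  (line_poly i v q).[t] = q.@[fun j => v j + (j == i)%:R * t].
Proof.
elim/mpolyind: q => [|c m q _ _ IH].
  by rewrite /line_poly !raddf0 horner0.
rewrite /line_poly in IH *; rewrite raddfD /= hornerD IH mevalD; congr (_ + _).
rewrite mmapZ hornerM hornerC mevalZ mmapX mevalX; congr (_ * _).
rewrite /mmap1 horner_prod; apply: eq_bigr => j _.
by rewrite horner_exp hornerD hornerC hornerZ hornerX.
Qed.

Lemma line_poly_deriv i v q : (line_poly i v q)^`() = line_poly i v q^`M(i).
Proof.
pose good q := (line_poly i v q)^`() = line_poly i v q^`M(i).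
have goodD p r : good p -> good r -> good (p + r).
  by rewrite /good /line_poly => hp hr; rewrite !raddfD /= hp hr.
have goodM p r : good p -> good r -> good (p * r).
  rewrite /good /line_poly => hp hr; rewrite rmorphM /= derivM hp hr mderivM.
  by rewrite raddfD /= !rmorphM.
have good1 : good 1.
  by rewrite /good /line_poly rmorph1 derivC -mpolyC1 mderivC raddf0.
have goodZ c p : good p -> good (c *: p).
  rewrite /good /line_poly => hp; rewrite mmapZ derivM derivC mul0r add0r hp.
  by rewrite mderivZ mmapZ.
have goodX j : good 'X_j.
  rewrite /good /line_poly mmapX mmap1U derivD derivC add0r derivZ derivX.
  rewrite mderivX mnm1E mmapZ mmapX.
  have -> : ((U_(j) - U_(i))%MM : 'X_{1..n}) = if j == i then 0%MM else U_(j)%MM.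
    apply/mnmP => k; rewrite mnmBE !mnm1E; case: (eqVneq j i) => [->|nji].
      by rewrite subnn mnm0E.
    rewrite mnm1E; case: (eqVneq j k) => [<-|]; last by rewrite sub0n.
    by rewrite eq_sym (negPf nji).
  case: eqP => _; rewrite ?scale0r ?mul0r //.
  by rewrite mmap11 mulr1 scale1r.
suff: good q by [].
elim/mpolyind: q => [|c m q _ _ IH]; first by rewrite -(scale0r 1); apply: goodZ.
apply: goodD => //; apply: goodZ; rewrite mpolyXE_id.
elim/big_ind: _ => // j _; elim: (m j) => [|k IHk]; first by rewrite expr0.
by rewrite exprS; apply: goodM.
Qed.

Lemma poly_int_roots (p : {poly rat}) : (forall k : int, p.[k%:~R] = 0) -> p = 0.
Proof.
move=> p0; apply/eqP/negPn/negP => nzp.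
pose s := [seq (k%:R : rat) | k <- iota 0 (size p)].
have: (size s < size p)%N.
  apply: max_poly_roots => //.
    by apply/allP => _ /mapP [k _ ->]; apply/rootP; exact: (p0 k).
  by rewrite map_inj_uniq ?iota_uniq // => a b /eqP; rewrite eqr_nat => /eqP.
by rewrite size_map size_iota ltnn.
Qed.

Lemma meval_at0 q : q.@[fun=> 0] = q@_0.
Proof.
elim/mpolyind: q => [|c m q _ _ IH]; first by rewrite meval0 mcoeff0.
rewrite mevalD IH mevalZ mcoeffD mcoeffZ mevalX mcoeffX; congr (_ * _ + _).
have [->|nz] := eqVneq m 0%MM.
  by rewrite big1 // => i _; rewrite mnm0E expr0.
have /existsP [i mi] : [exists i, m i != 0%N].
  apply: contraR nz => /existsPn m0; apply/eqP/mnmP => i.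
  by rewrite mnm0E; apply/eqP/negbNE/m0.
by rewrite (bigD1 i) //= expr0n (negPf mi) mul0r.
Qed.

Lemma mpoly_int_zeros q :
  (forall c : {ffun 'I_n -> int}, q.@[fun i => (c i)%:~R] = 0) -> q = 0.
Proof.
pose van q := forall c : {ffun 'I_n -> int}, q.@[fun i => (c i)%:~R] = 0.
have vanD i p : van p -> van p^`M(i).
  move=> vp c; set v := fun i => _; have p0 : line_poly i v p = 0.
    apply: poly_int_roots => k.
    rewrite line_polyE -[RHS](vp [ffun j => c j + (j == i)%:R * k]).
    by apply: meval_eq => j; rewrite ffunE rmorphD rmorphM /= rmorph_nat.
  have := line_polyE i v p^`M(i) 0; rewrite -line_poly_deriv p0 deriv0 horner0 => E.
  by rewrite [RHS]E; apply: meval_eq => j; rewrite mulr0 addr0.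
have vanM m p : van p -> van p^`M[m].
  move=> vp; rewrite mderivm_foldr; elim: (flatten _) => //= i s IH.
  exact: vanD.
move=> vq; apply/mpolyP => m; rewrite mcoeff0.
have := vanM m q vq [ffun=> 0].
rewrite (_ : _.@[_] = (q^`M[m])@_0); last first.
  rewrite -meval_at0; by apply: meval_eq => i; rewrite ffunE.
rewrite mcoeff_mderivm addm0 => /eqP; rewrite mulrn_eq0 => /orP [|/eqP //].
by rewrite -leqn0 leqNgt prodn_gt0 // => i; rewrite ffact_gt0.
Qed.

End MDiff.

Section Representation.
Variables (n : nat) (L : zmodType) (e : lattice_basis n L).
Implicit Types (f h : polyfun e) (q : {mpoly rat[n]}).

Lemma pf_repP h x : h x = (pf_rep h).@[qcoord e x].
Proof. by rewrite /pf_rep; case: cid => q /= hq; apply: hq. Qed.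

Lemma polyfun_eq f h : f =1 h -> f = h.
Proof.
case: f h => [f fP] [h hP] /= /funext fh.
by subst h; congr PolyFun; apply: Prop_irrelevance.
Qed.

Lemma pf_repK : cancel (@pf_rep n L e) (@polyfun_of n L e).
Proof. by move=> h; apply: polyfun_eq => x; rewrite [RHS]pf_repP. Qed.

Lemma polyfun_ofK : cancel (@polyfun_of n L e) (@pf_rep n L e).
Proof.
move=> q; apply/eqP; rewrite -subr_eq0; apply/eqP/mpoly_int_zeros => c.
pose x := \sum_(i < n) e i *~ c i; have := pf_repP (polyfun_of e q) x.
rewrite mevalB (_ : (fun i => (c i)%:~R) = qcoord e x) => [<-|].
  by rewrite subrr.
by apply: funext => i; rewrite /qcoord coord_sum.
Qed.

End Representation.

Definition series (n : nat) : Type := 'X_{1..n} -> rat.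

HB.instance Definition _ n := gen_eqMixin (series n).
HB.instance Definition _ n := gen_choiceMixin (series n).

Section Series.
Variable n : nat.
Implicit Types (a b c : series n) (p q : {mpoly rat[n]}) (m : 'X_{1..n}).

Definition series_trunc k a : {mpoly rat[n]} :=
  \sum_(m : 'X_{1..n < k}) a m *: 'X_[m].

Definition series_add a b : series n := fun m => a m + b m.
Definition series_opp a : series n := fun m => - a m.
Definition series_zero : series n := fun=> 0.
Definition series_one : series n := fun m => (m == 0%MM)%:R.
Definition series_scale (x : rat) a : series n := fun m => x * a m.

Definition series_mul a b : series n := fun m =>
  \sum_(k : 'X_{1..n < (mdeg m).+1, (mdeg m).+1} | m == (k.1 + k.2)%MM)
    a k.1 * b k.2.

Fact series_addA : associative series_add.
Proof. by move=> a b c; apply: funext => m; apply: addrA. Qed.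
Fact series_addC : commutative series_add.
Proof. by move=> a b; apply: funext => m; apply: addrC. Qed.
Fact series_add0 : left_id series_zero series_add.
Proof. by move=> a; apply: funext => m; apply: add0r. Qed.
Fact series_addN : left_inverse series_zero series_opp series_add.
Proof. by move=> a; apply: funext => m; apply: addNr. Qed.

HB.instance Definition _ := GRing.isZmodule.Build (series n)
  series_addA series_addC series_add0 series_addN.

Let agree k p a := forall m, (mdeg m < k)%N -> p@_m = a m.

Let agree_trunc k a : agree k (series_trunc k a) a.
Proof. by move=> m; apply: mcoeff_mpoly. Qed.

Let agreeM k p q a b : agree k p a -> agree k q b -> agree k (p * q) (series_mul a b).
Proof.
move=> pa qb m mk; rewrite mcoeffM; apply: eq_bigr => -[[m1 lt1] [m2 lt2]] _ /=.
by rewrite pa ?qb //; apply: leq_trans mk; rewrite ltnS.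
Qed.

Let agreeD k p q a b : agree k p a -> agree k q b -> agree k (p + q) (a + b).
Proof. by move=> pa qb m mk; rewrite mcoeffD pa // qb. Qed.

Let agree1 k : agree k 1 series_one.
Proof. by move=> m _; rewrite mcoeff1. Qed.

Let agree_eq a b : (forall k, exists2 p, agree k p a & agree k p b) -> a = b.
Proof.
move=> ab; apply: funext => m; have [p pa pb] := ab (mdeg m).+1.
by rewrite -pa // -pb.
Qed.

Fact series_mulA : associative series_mul.
Proof.
move=> a b c; apply: agree_eq => k.
exists (series_trunc k a * (series_trunc k b * series_trunc k c)).
  by do 2?apply: agreeM.
by rewrite mulrA; do 2?apply: agreeM.
Qed.

Fact series_mulC : commutative series_mul.
Proof.
move=> a b; apply: agree_eq => k; exists (series_trunc k a * series_trunc k b).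
  exact: agreeM.
by rewrite mulrC; apply: agreeM.
Qed.

Fact series_mul1 : left_id series_one series_mul.
Proof.
move=> a; apply: agree_eq => k; exists (1 * series_trunc k a); first exact: agreeM.
by rewrite mul1r; apply: agree_trunc.
Qed.

Fact series_mulDl : left_distributive series_mul +%R.
Proof.
move=> a b c; apply: agree_eq => k.
exists ((series_trunc k a + series_trunc k b) * series_trunc k c).
  by apply: agreeM => //; apply: agreeD.
by rewrite mulrDl; apply: agreeD; apply: agreeM.
Qed.

Fact series_one_neq0 : series_one != 0.
Proof. by apply/eqP => /(congr1 (@^~ 0%MM)); rewrite /series_one eqxx. Qed.

HB.instance Definition _ := GRing.Zmodule_isComNzRing.Build (series n)
  series_mulA series_mulC series_mul1 series_mulDl series_one_neq0.

Fact series_scaleA x y a : series_scale x (series_scale y a) = series_scale (x * y) a.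
Proof. by apply: funext => m; apply: mulrA. Qed.
Fact series_scale1 : left_id 1 series_scale.
Proof. by move=> a; apply: funext => m; apply: mul1r. Qed.
Fact series_scaleDr : right_distributive series_scale +%R.
Proof. by move=> x a b; apply: funext => m; apply: mulrDr. Qed.
Fact series_scaleDl a : {morph series_scale^~ a : x y / x + y}.
Proof. by move=> x y; apply: funext => m; apply: mulrDl. Qed.

HB.instance Definition _ := GRing.Zmodule_isLmodule.Build rat (series n)
  series_scaleA series_scale1 series_scaleDr series_scaleDl.

Fact series_scaleAl (x : rat) a b : x *: (a * b) = (x *: a) * b.
Proof.
apply: funext => m; rewrite [LHS]mulr_sumr; apply: eq_bigr => k _.
exact: mulrA.
Qed.

HB.instance Definition _ := GRing.Lmodule_isLalgebra.Build rat (series n)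
  series_scaleAl.
HB.instance Definition _ := GRing.Lalgebra_isComAlgebra.Build rat (series n).

Lemma series_addE a b m : (a + b) m = a m + b m. Proof. by []. Qed.
Lemma series_oppE a m : (- a) m = - a m. Proof. by []. Qed.
Lemma series_scaleE x a m : (x *: a) m = x * a m. Proof. by []. Qed.
Lemma series_oneE m : (1 : series n) m = (m == 0%MM)%:R. Proof. by []. Qed.
Lemma series_mulE a b m : (a * b) m =
  \sum_(k : 'X_{1..n < (mdeg m).+1, (mdeg m).+1} | m == (k.1 + k.2)%MM)
    a k.1 * b k.2.
Proof. by []. Qed.
Lemma series_sumE I (r : seq I) (P : pred I) (F : I -> series n) m :
  (\sum_(i <- r | P i) F i) m = \sum_(i <- r | P i) F i m.
Proof. by apply: (big_morph (fun a : series n => a m)). Qed.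

Lemma series_mul0E a b : (a * b) 0%MM = a 0%MM * b 0%MM.
Proof.
have H := agreeM (@agree_trunc 1 a) (@agree_trunc 1 b).
rewrite -[LHS]H ?mdeg0 // rmorphM /=.
by congr (_ * _); apply: (@agree_trunc 1); rewrite mdeg0.
Qed.

Let vanish k a := forall m, (mdeg m < k)%N -> a m = 0.

Let vanishM i j a b : vanish i a -> vanish j b -> vanish (i + j) (a * b).
Proof.
move=> ai bj m mk; rewrite series_mulE big1 // => -[m1 m2] /= /eqP mE.
have [/ai ->|im] := ltnP (mdeg m1) i; first by rewrite mul0r.
rewrite bj ?mulr0 // -(ltn_add2l i); apply: leq_ltn_trans mk.
have dE : mdeg m = (mdeg m1 + mdeg m2)%N := etrans (congr1 mdeg mE) (mdegD _ _).
by apply: leq_trans (eq_leq (esym dE)); rewrite leq_add2r.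
Qed.

Let vanishX k a : a 0%MM = 0 -> vanish k (a ^+ k).
Proof.
move=> a0; elim: k => [|k IH]; first by move=> m.
rewrite exprS -add1n; apply: vanishM => // m.
by rewrite ltnS leqn0 mdeg_eq0 => /eqP ->.
Qed.

(* Coefficientwise the sum is finite, as b ^+ j has no term of degree < j. *)
Definition geometric b : series n := fun m => \sum_(j < (mdeg m).+1) (b ^+ j) m.

Definition series_unit : {pred series n} := fun a => a 0%MM != 0.

Definition series_inv a : series n :=
  if a \in series_unit
  then (a 0%MM)^-1 *: geometric (1 - (a 0%MM)^-1 *: a) else a.

Let power_sum (w : nat -> rat) b : series n :=
  fun m => \sum_(j < (mdeg m).+1) w j * (b ^+ j) m.

Let power_sum_mul w b c k m : b 0%MM = 0 -> (mdeg m < k)%N ->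
  (c * power_sum w b) m = (c * \sum_(j < k) w j *: b ^+ j) m.
Proof.
move=> b0 mk; rewrite !series_mulE; apply: eq_bigr => -[[m1 lt1] [m2 lt2]] _ /=.
congr (_ * _); rewrite series_sumE /power_sum.
have le2 : ((mdeg m2).+1 <= k)%N by apply: leq_trans mk.
rewrite (big_ord_widen _ (fun j => w j * (b ^+ j) m2) le2) big_mkcond /=.
apply: eq_bigr => j _; rewrite series_scaleE; case: ltnP => // ltj.
by rewrite vanishX ?mulr0.
Qed.

Lemma geometricP b : b 0%MM = 0 -> (1 - b) * geometric b = 1.
Proof.
move=> b0; apply: funext => m; pose k := (mdeg m).+1.
have -> : geometric b = power_sum (fun=> 1) b.
  by apply: funext => m'; apply: eq_bigr => j _; rewrite mul1r.
rewrite (@power_sum_mul _ _ _ k) // (eq_bigr (fun j : 'I_k => b ^+ j)); last first.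
  by move=> j _; rewrite scale1r.
rewrite -[in RHS](subr0 1) [RHS]series_addE.
have -> : (1 - b) * \sum_(j < k) b ^+ j = 1 - b ^+ k.
  by rewrite -[1 - b ^+ k]opprB subrX1 -mulNr opprB.
by rewrite series_addE !series_oppE vanishX.
Qed.

Fact series_mulV : {in series_unit, left_inverse 1 series_inv *%R}.
Proof.
move=> a ua; rewrite /series_inv ua mulrC -scalerAr scalerAl.
set c := _^-1; set b := 1 - c *: a.
have -> : c *: a = 1 - b by rewrite /b opprB addrC subrK.
apply: geometricP; rewrite /b series_addE series_oppE series_scaleE series_oneE eqxx.
by rewrite mulVf // subrr.
Qed.

Fact series_unitP a b : b * a = 1 -> a \in series_unit.
Proof.
move=> /(congr1 (@^~ 0%MM)); rewrite series_mul0E series_oneE eqxx => ab.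
by apply/eqP => a0; move/eqP: ab; rewrite a0 mulr0 eq_sym oner_eq0.
Qed.

Fact series_inv_out : {in [predC series_unit], series_inv =1 id}.
Proof. by move=> a; rewrite inE /= /series_inv => /negPf ->. Qed.

HB.instance Definition _ := GRing.ComNzRing_hasMulInverse.Build (series n)
  series_mulV series_unitP series_inv_out.

Lemma series_unitE a : (a \is a GRing.unit) = (a 0%MM != 0).
Proof. by []. Qed.

Definition qbinom (x : rat) j : rat := (\prod_(i < j) (x - i%:R)) / (j`!)%:R.

Lemma qbinomS x j : qbinom (x + 1) j.+1 = qbinom x j.+1 + qbinom x j.
Proof.
rewrite /qbinom big_ord_recl big_ord_recr /= subr0.
rewrite (eq_bigr (fun i : 'I_j => x - i%:R)); last first.
  by move=> i _; rewrite /bump /= add1n -natr1; ring.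
rewrite factS natrM.
have nz1 : (j`!)%:R != 0 :> rat by rewrite pnatr_eq0 -lt0n fact_gt0.
have nz2 : j.+1%:R != 0 :> rat by rewrite pnatr_eq0.
by rewrite -natr1 in nz2 *; field; rewrite nz1 nz2.
Qed.

Lemma qbinom0 x : qbinom x 0 = 1.
Proof. by rewrite /qbinom big_ord0 fact0 divr1. Qed.

Lemma qbinom0S j : qbinom 0 j.+1 = 0.
Proof. by rewrite /qbinom big_ord_recl subrr !mul0r. Qed.

Let zpow (b : series n) (x : rat) := power_sum (qbinom x) b.

Let zpowS b x : b 0%MM = 0 -> zpow b (x + 1) = (1 + b) * zpow b x.
Proof.
move=> b0; apply: funext => m; rewrite (@power_sum_mul _ _ _ (mdeg m).+1) //.
rewrite mulrDl mul1r mulr_sumr.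
set S2 := \sum_(i < _) b * _.
have {S2}-> : S2 = \sum_(j < mdeg m) qbinom x j *: b ^+ j.+1
                    + qbinom x (mdeg m) *: b ^+ (mdeg m).+1.
  by rewrite /S2 big_ord_recr /=; congr (_ + _); [apply: eq_bigr => j _|];
    rewrite -scalerAr exprS.
rewrite addrA [RHS]series_addE [X in _ = _ + X]series_scaleE vanishX // mulr0 addr0.
rewrite big_ord_recl -addrA -big_split /= series_addE series_sumE.
rewrite [LHS]big_ord_recl /= !qbinom0 scale1r mul1r; congr (_ + _).
by apply: eq_bigr => j _; rewrite /bump /= add1n qbinomS -scalerDl series_scaleE.
Qed.

Lemma series_exprz a (k : int) m : a 0%MM = 1 ->
  (a ^ k) m = \sum_(j < (mdeg m).+1) qbinom k%:~R j * ((a - 1) ^+ j) m.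
Proof.
move=> a0; have b0 : (a - 1) 0%MM = 0.
  by rewrite series_addE a0 series_oppE series_oneE eqxx subrr.
have ua : a \is a GRing.unit by rewrite series_unitE a0 oner_neq0.
suff -> : a ^ k = zpow (a - 1) k%:~R by [].
have zS x : zpow (a - 1) (x + 1) = a * zpow (a - 1) x.
  by rewrite zpowS // addrC subrK.
have z0 : zpow (a - 1) 0 = 1.
  apply: funext => m'; rewrite /zpow /power_sum big_ord_recl big1 ?addr0 /=.
    by rewrite qbinom0 mul1r expr0.
  by move=> j _; rewrite qbinom0S mul0r.
elim/int_ind: k {m} => [|k IH|k IH].
- by rewrite expr0z z0.
- by rewrite -addn1 PoszD rmorphD /= zS -IH exprzDr // expr1z mulrC.
- apply: (mulrI ua); rewrite -zS -{1}[a]expr1z -exprzDr //.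
  have -> : 1 + - (k.+1%:Z) = - k%:Z by rewrite -addn1 PoszD; ring.
  rewrite IH; congr zpow; rewrite -addn1 PoszD opprD rmorphD /=; ring.
Qed.

End Series.

Definition sh_act (L : zmodType) (E : Sh L) (h : L -> rat) (x : L) : rat :=
  \sum_(u <- dom E) (coeff u E)%:~R * h (x + u).

Lemma sh_actE (L : zmodType) (E : Sh L) h x :
  sh_act E h x = grp_lift (fun u => h (x + u) : zmodule rat) E.
Proof. by apply: eq_bigr => u _; rewrite mulrC mulrzr. Qed.

Lemma sh_act_translation (L : zmodType) u (h : L -> rat) x :
  sh_act (translation int u) h x = h (x + u).
Proof. by rewrite sh_actE grp_liftU scale1r. Qed.

Lemma sh_actM (L : zmodType) (D E : Sh L) h x :
  sh_act (D * E) h x = sh_act D (sh_act E h) x.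
Proof.
have act0 g y : sh_act (0 : Sh L) g y = 0 by rewrite sh_actE linear0.
have actD F G g y : sh_act (F + G : Sh L) g y = sh_act F g y + sh_act G g y.
  by rewrite !sh_actE linearD.
have actU (a : int) u g y : sh_act (<< a *g u >> : Sh L) g y = g (y + u) *~ a.
  by rewrite sh_actE grp_liftU.
have act0r (F : Sh L) g y : g =1 (fun=> 0) -> sh_act F g y = 0.
  by move=> g0; rewrite /sh_act big1 // => u _; rewrite g0 mulr0.
have actDr (F : Sh L) g1 g2 g y : g =1 (fun z => g1 z + g2 z) ->
    sh_act F g y = sh_act F g1 y + sh_act F g2 y.
  move=> gE; rewrite /sh_act -big_split; apply: eq_bigr => u _.
  by rewrite gE mulrDr.
elim/grp_ind: D => [|a u|D D' IH IH'].
- by rewrite mul0r !act0.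
- elim/grp_ind: E => [|b v|E E' IH IH'].
  + by rewrite mulr0 act0 act0r.
  + by rewrite [_ * _]grpring_mulUU !actU addrA mulrzA mulrzAC.
  + rewrite mulrDr actD IH IH'; apply/esym/actDr => z; exact: actD.
- by rewrite mulrDl !actD IH IH'.
Qed.

Definition Diff (n : nat) := {mpoly int[n]}.
Definition DiffQ (n : nat) := {mpoly rat[n]}.

Definition DiffQ_of_Diff n : Diff n -> DiffQ n := map_mpoly intr.

Section Operators.
Variables (n : nat) (L : zmodType) (e : lattice_basis n L).
Implicit Types (f g h : polyfun e).

Definition diffQ_act (D : DiffQ n) h : polyfun e :=
  polyfun_of e (mdiff D (pf_rep h)).

Definition diff_act (D : Diff n) h : polyfun e := diffQ_act (DiffQ_of_Diff D) h.

Definition series_act (D : series n) h : polyfun e :=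
  diffQ_act (series_trunc (msize (pf_rep h)) D) h.

Lemma diffQ_actM D E h : diffQ_act (D * E) h = diffQ_act D (diffQ_act E h).
Proof. by rewrite /diffQ_act polyfun_ofK mdiffM. Qed.

(* 'X_i acts as the directional derivative along e i. *)
Lemma diffQ_act_deriv i h x (p : {poly rat}) :
  (forall t : int, p.[t%:~R] = h (x + e i *~ t)) ->
  diffQ_act 'X_i h x = p^`().[0].
Proof.
move=> hp; have -> : p = line_poly i (qcoord e x) (pf_rep h).
  apply/eqP; rewrite -subr_eq0; apply/eqP/poly_int_roots => t.
  rewrite hornerD hornerN line_polyE hp pf_repP; apply/eqP; rewrite subr_eq0.
  apply/eqP/meval_eq => j; rewrite /qcoord coordD ffunE rmorphD /=; congr (_ + _).
  have -> : e i *~ t = \sum_(k < n) e k *~ [ffun k => (k == i)%:R * t] k.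
    rewrite (bigD1 i) //= big1 => [|k /negPf nki]; rewrite ffunE ?nki ?mul0r //.
    by rewrite eqxx mul1r addr0.
  by rewrite coord_sum ffunE rmorphM /= rmorph_nat.
rewrite line_poly_deriv line_polyE /= mdiffX mderivmU1m.
by apply: meval_eq => j; rewrite mulr0 addr0.
Qed.

Fact ann_Sh_zmod_closed (f : L -> rat) :
  zmod_closed (fun E : Sh L => `[< forall x, sh_act E f x = 0 >]).
Proof.
split=> [|D E /asboolP D0 /asboolP E0]; apply/asboolP => x.
  by rewrite sh_actE linear0.
by rewrite sh_actE linearB /= -!sh_actE D0 E0 subrr.
Qed.

Fact ann_Sh_absorb (f : L -> rat) (D E : Sh L) :
  E \in (fun E : Sh L => `[< forall x, sh_act E f x = 0 >]) ->
  D * E \in (fun E : Sh L => `[< forall x, sh_act E f x = 0 >]).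
Proof.
move=> /asboolP E0; apply/asboolP => x; rewrite sh_actM /sh_act big1 // => u _.
by rewrite [X in _ * X]E0 mulr0.
Qed.

Definition ann_Sh (f : L -> rat) : ideal (Sh L) :=
  Ideal (ann_Sh_zmod_closed f) (@ann_Sh_absorb f).

Lemma diff_act_eq0 (D : Diff n) h :
  (forall x, diff_act D h x = 0) <-> mdiff (DiffQ_of_Diff D) (pf_rep h) = 0.
Proof.
split=> [D0|D0 x]; last by rewrite /diff_act /= D0 meval0.
rewrite -[LHS](polyfun_ofK e) -[RHS](polyfun_ofK e); congr pf_rep.
by apply: polyfun_eq => x; rewrite [LHS]D0 /= meval0.
Qed.

Fact ann_Diff_zmod_closed h :
  zmod_closed (fun D : Diff n => `[< forall x, diff_act D h x = 0 >]).
Proof.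
split=> [|D E /asboolP/diff_act_eq0 D0 /asboolP/diff_act_eq0 E0];
  apply/asboolP/diff_act_eq0; first by rewrite /DiffQ_of_Diff raddf0 mdiff0l.
rewrite /DiffQ_of_Diff raddfB /= mdiffDl D0 add0r.
by rewrite -scaleN1r mdiffZl E0 scaler0.
Qed.

Fact ann_Diff_absorb h (D E : Diff n) :
  E \in (fun E : Diff n => `[< forall x, diff_act E h x = 0 >]) ->
  D * E \in (fun E : Diff n => `[< forall x, diff_act E h x = 0 >]).
Proof.
move=> /asboolP/diff_act_eq0 E0; apply/asboolP/diff_act_eq0.
by rewrite /DiffQ_of_Diff rmorphM /= mdiffM E0 linear0.
Qed.

Definition ann_Diff h : ideal (Diff n) :=
  Ideal (ann_Diff_zmod_closed h) (@ann_Diff_absorb h).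

Definition differentially_equivalent f h : Prop := ann_Diff f =i ann_Diff h.

(* Q (x) K_f and Q (x) A_g: tensoring with Q is exact, so Q (x) (R / I) is the
   quotient of Q (x) R by the ideal generated by I. *)
Definition QK f := quot_ring (extend_ideal (@ShQ_of_Sh L) (ann_Sh f)).

Definition QA g := quot_ring (extend_ideal (@DiffQ_of_Diff n) (ann_Diff g)).

Definition QK_class f (E : ShQ L) : QK f := quot_proj _ E.

Definition QA_act g (a : QA g) : polyfun e := diffQ_act (quot_repr a) g.

Definition QA_class g (D : DiffQ n) : QA g := quot_proj _ D.

(* Monomials of degree at least [msize (pf_rep g)] kill g. *)
Definition QA_of_series g (D : series n) : QA g :=
  QA_class g (series_trunc (msize (pf_rep g)) D).

Definition QA_deg g (a : QA g) : rat := QA_act a 0.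

Definition chi f (E : Sh L) : rat := sh_act E f 0.

Lemma extend_ann_Diff g D :
  D \in extend_ideal (@DiffQ_of_Diff n) (ann_Diff g) -> mdiff D (pf_rep g) = 0.
Proof.
move=> /asboolP [s [hs ->]]; elim: s hs => [|[c E] s IH] /=.
  by rewrite big_nil mdiff0l.
move=> /andP [/asboolP/diff_act_eq0 E0 hs].
by rewrite big_cons mdiffDl IH // mdiffM E0 linear0 addr0.
Qed.

Lemma QA_act_class g D : QA_act (QA_class g D) = diffQ_act D g.
Proof.
rewrite /QA_act /diffQ_act; congr polyfun_of; apply/eqP; rewrite -subr_eq0.
rewrite -scaleN1r -mdiffZl -mdiffDl scaleN1r; apply/eqP/extend_ann_Diff.
exact: quot_repr_proj.
Qed.

Lemma QA_act_series g D : QA_act (QA_of_series g D) = series_act D g.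
Proof. exact: QA_act_class. Qed.

Lemma series_truncwE k (D : series n) (q : {mpoly rat[n]}) :
  mdiff (series_trunc k D) q = \sum_(m : 'X_{1..n < k}) D m *: q^`M[m].
Proof.
rewrite /series_trunc (big_morph _ (fun A B => mdiffDl A B q) (mdiff0l q)).
by apply: eq_bigr => m _; rewrite mdiffZl mdiffX.
Qed.

(* The coefficients of p(t) = 1 + a_1 t + a_2 t^2 + ...; a 0 is ignored. *)
Definition pcoef (a : nat -> rat) (k : nat) : rat := if k is 0 then 1 else a k.

(* p(d), where d is the derivative along e i, as a series in n variables. *)
Definition pseries (a : nat -> rat) (i : 'I_n) : series n :=
  fun m => if m == (U_(i) *+ m i)%MM then pcoef a (m i) else 0.

Definition phi (a : nat -> rat) (E : ShQ L) : series n :=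
  grp_lift (fun u => \prod_(i < n) pseries a i ^ coord e u i) E.

Lemma pseries0 a i : pseries a i 0%MM = 1.
Proof. by rewrite /pseries mnm0E mulm0n eqxx. Qed.

Lemma pseries_unit a i : pseries a i \is a GRing.unit.
Proof. by rewrite series_unitE pseries0 oner_neq0. Qed.

Lemma phi_basis a i : phi a (translation rat (e i)) = pseries a i.
Proof.
rewrite /phi grp_liftU scale1r coord_basis (bigD1 i) //= ffunE eqxx expr1z.
by rewrite big1 ?mulr1 // => j /negPf nij; rewrite ffunE nij expr0z.
Qed.

Fact phi_is_linear a : linear (phi a).
Proof. exact: linearP. Qed.

Fact phi_is_monoid_morphism a : monoid_morphism (phi a).
Proof.
split; last first.
  apply: grp_lift_mul => u v; rewrite -big_split; apply: eq_bigr => i _.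
  by rewrite coordD ffunE exprzDr // pseries_unit.
rewrite /phi grp_liftU scale1r coord0 big1 // => i _.
by rewrite ffunE expr0z.
Qed.

HB.instance Definition _ a :=
  GRing.isLinear.Build rat (ShQ L) (series n) _ (phi a) (phi_is_linear a).
HB.instance Definition _ a :=
  GRing.isMonoidMorphism.Build (ShQ L) (series n) (phi a)
    (phi_is_monoid_morphism a).

Definition phi_QA a g (E : ShQ L) : QA g := QA_of_series g (phi a E).

Section PolyfunClosure.

Fact is_polyfun_cst c : is_polyfun e (fun=> c).
Proof. by exists c%:MP => x; rewrite mevalC. Qed.

Fact is_polyfun_coord i : is_polyfun e (fun x => qcoord e x i).
Proof. by exists 'X_i => x; rewrite mevalXU. Qed.

Fact is_polyfunD (f1 f2 : L -> rat) : is_polyfun e f1 -> is_polyfun e f2 ->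
  is_polyfun e (fun x => f1 x + f2 x).
Proof. by move=> [p hp] [q hq]; exists (p + q) => x; rewrite mevalD hp hq. Qed.

Fact is_polyfunM (f1 f2 : L -> rat) : is_polyfun e f1 -> is_polyfun e f2 ->
  is_polyfun e (fun x => f1 x * f2 x).
Proof. by move=> [p hp] [q hq]; exists (p * q) => x; rewrite mevalM hp hq. Qed.

Fact is_polyfun_sum I (r : seq I) (P : pred I) (F : I -> L -> rat) :
  (forall i, is_polyfun e (F i)) ->
  is_polyfun e (fun x => \sum_(i <- r | P i) F i x).
Proof.
move=> hF; elim: r => [|i r [q hq]].
  by exists 0 => x; rewrite big_nil meval0.
have [p hp] := hF i; exists (if P i then p + q else q) => x.
by rewrite big_cons; case: (P i); rewrite ?mevalD hq ?hp.
Qed.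

Fact is_polyfun_prod I (r : seq I) (F : I -> L -> rat) :
  (forall i, is_polyfun e (F i)) -> is_polyfun e (fun x => \prod_(i <- r) F i x).
Proof.
move=> hF; elim: r => [|i r [q hq]].
  by exists 1 => x; rewrite big_nil meval1.
have [p hp] := hF i; exists (p * q) => x.
by rewrite big_cons mevalM hq hp.
Qed.

Fact is_polyfun_phi a m : is_polyfun e (fun u => phi a (translation rat u) m).
Proof.
pose P i u := pseries a i ^ coord e u i.
have polyP i m' : is_polyfun e (fun u => P i u m').
  have -> : (fun u => P i u m') = (fun u => \sum_(j < (mdeg m').+1)
      (\prod_(l < j) (qcoord e u i - l%:R) * (j`!)%:R^-1)
        * ((pseries a i - 1) ^+ j) m').
    by apply: funext => u; rewrite /P series_exprz ?pseries0.
  apply: is_polyfun_sum => j.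
  apply: (is_polyfunM (f2 := fun=> _)); last exact: is_polyfun_cst.
  apply: (is_polyfunM (f2 := fun=> _)); last exact: is_polyfun_cst.
  apply: is_polyfun_prod => l.
  apply: (is_polyfunD (f2 := fun=> _)); last exact: is_polyfun_cst.
  exact: is_polyfun_coord.
have -> : (fun u => phi a (translation rat u) m) = (fun u => (\prod_(i < n) P i u) m).
  by apply: funext => u; rewrite /phi grp_liftU scale1r.
elim: (index_enum _) m => [|i s IH] m.
  by have [q hq] := is_polyfun_cst ((1 : series n) m); exists q => u;
    rewrite big_nil.
have -> : (fun u => (\prod_(j <- i :: s) P j u) m) =
    (fun u => \sum_(k : 'X_{1..n < (mdeg m).+1, (mdeg m).+1} | m == (k.1 + k.2)%MM)
       P i u k.1 * (\prod_(j <- s) P j u) k.2).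
  by apply: funext => u; rewrite big_cons.
by apply: is_polyfun_sum => k; apply: is_polyfunM.
Qed.

End PolyfunClosure.

Definition Psi_fun a h (u : L) : rat := series_act (phi a (translation rat u)) h 0.

Fact Psi_is_polyfun a h : is_polyfun e (Psi_fun a h).
Proof.
pose q := pf_rep h.
have -> : Psi_fun a h = (fun u => \sum_(m : 'X_{1..n < msize q})
    phi a (translation rat u) m * (q^`M[m]).@[qcoord e 0]).
  apply: funext => u; rewrite /Psi_fun /= series_truncwE raddf_sum /=.
  by apply: eq_bigr => m _; rewrite mevalZ.
apply: is_polyfun_sum => m; apply: is_polyfunM; first exact: is_polyfun_phi.
exact: is_polyfun_cst.
Qed.

Definition Psi a h : polyfun e := PolyFun (Psi_is_polyfun a h).

End Operators.

(* Main.v *)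
(* For p = exp, Taylor's formula says that phi_exp(T^u) acts on polynomials as the
   shift by u.  Since a_1 <> 0, p(t) - 1 has a compositional inverse to any finite
   order, so modulo operators of high order every differential operator is of the
   form phi_p(E); for p = exp this makes shifts and derivatives have the same
   annihilators.  The intertwining relation E Psi_p(h) = Psi_p(phi_p(E) h) and the
   injectivity of Psi_p then give Ann_Sh(Psi_p(g)) = ker(Sh_Q -> QA_g), and each of
   (1)-(4) says that this ideal is also Ann_Sh(f).  The unit td comes from Macaulay
   duality: polynomials with equal annihilators are derivatives of each other. *)

Require Import Defs.
From HB Require Import structures.
From mathcomp Require Import all_boot all_order all_algebra.
From mathcomp Require Import boolp ring.

Set Implicit Arguments.
Unset Strict Implicit.
Unset Printing Implicit Defensive.

Import GRing.Theory Num.Theory.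
Local Open Scope ring_scope.

(** * Power series of derivatives acting on polynomials *)

Section SeriesAction.
Variable n : nat.
Implicit Types (D E p q : {mpoly rat[n]}) (s t : series n) (m : 'X_{1..n}).

Lemma mderivm_eq0 m q : (msize q <= mdeg m)%N -> q^`M[m] = 0.
Proof.
move=> le_qm; apply/mpolyP => m'; rewrite mcoeff_mderivm mcoeff0.
rewrite memN_msupp_eq0 ?mul0rn //; apply: msize_mdeg_ge.
by rewrite mdegD (leq_trans le_qm) // leq_addr.
Qed.

(* [s] acting on [q]; the series comes last so that [sact q] is a linear map. *)
Definition sact q s : {mpoly rat[n]} := mdiff (series_trunc (msize q) s) q.

(** Derivatives of order at least [msize q] kill [q], so only the coefficients below that degree
    matter. A series may thus be replaced by any polynomial that agrees with it there. *)
Lemma mdiff_sact D s q :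
  (forall m, (mdeg m < msize q)%N -> D@_m = s m) -> mdiff D q = sact q s.
Proof.
move=> Ds; rewrite /sact; set T := series_trunc _ _.
pose k := maxn (msize D) (msize T).
rewrite (mdiffwE _ (leq_maxl _ _ : msize D <= k)%N).
rewrite (mdiffwE _ (leq_maxr _ _ : msize T <= k)%N).
apply: eq_bigr => m _; have [ltm|lem] := ltnP (mdeg m) (msize q).
  by rewrite Ds // mcoeff_mpoly.
by rewrite mderivm_eq0 // !scaler0.
Qed.

Lemma series_trunc_act k s q :
  (msize q <= k)%N -> mdiff (series_trunc k s) q = sact q s.
Proof.
by move=> le_qk; apply: mdiff_sact => m ltm; rewrite mcoeff_mpoly // (leq_trans ltm).
Qed.

Lemma mul_agree k D E s t :
    (forall m, (mdeg m < k)%N -> D@_m = s m) ->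
    (forall m, (mdeg m < k)%N -> E@_m = t m) ->
  forall m, (mdeg m < k)%N -> (D * E)@_m = (s * t) m.
Proof.
move=> Ds Et m mk; rewrite mcoeffM; apply: eq_bigr => -[[m1 lt1] [m2 lt2]] _ /=.
by rewrite Ds ?Et //; apply: leq_trans mk; rewrite ltnS.
Qed.

(** Truncating both series at a common order [k] reduces this to composition of polynomial
    operators: the product of the truncations agrees with [s * t] below degree [k]. *)
Lemma sactM s t q : sact q (s * t) = sact (sact q t) s.
Proof.
pose k := maxn (msize q) (msize (sact q t)).
rewrite -(@series_trunc_act k s) ?leq_maxr // -(@series_trunc_act k t) ?leq_maxl //.
rewrite -mdiffM; apply/esym/mdiff_sact => m ltm.
by apply: (@mul_agree k); [move=> ? ?; apply: mcoeff_mpoly..|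
  rewrite (leq_trans ltm) ?leq_maxl].
Qed.

Lemma sact1 q : sact q 1 = q.
Proof. by rewrite -[RHS]mdiff1; apply/esym/mdiff_sact => m _; rewrite mcoeff1. Qed.

Lemma sact_linearl q : linear (sact q).
Proof.
move=> c s t; rewrite -mdiffZl -mdiffDl; apply/esym/mdiff_sact => m ltm.
by rewrite mcoeffD mcoeffZ !mcoeff_mpoly.
Qed.

HB.instance Definition _ q :=
  GRing.isLinear.Build rat (series n) {mpoly rat[n]} _ (sact q) (sact_linearl q).

Lemma sact0r s : sact 0 s = 0.
Proof. by rewrite /sact linear0. Qed.

End SeriesAction.

(** * Surjectivity of [phi] up to finite order *)

(* [r] is corrected by [c X^N], with [c] chosen so that the new error term
   [w - c Q^N] vanishes at 0. *)
Lemma comp_poly_inverse (F : fieldType) (Q : {poly F}) (N : nat) :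
  Q.[0] != 0 -> exists r w : {poly F}, r \Po ('X * Q) = 'X + 'X^N * w.
Proof.
move=> Q0; elim: N => [|N [r [w rE]]].
  by exists 0, (- 'X); rewrite comp_poly0 expr0 mul1r subrr.
pose c := w.[0] / Q.[0] ^+ N.
have /factor_theorem [v vE] : root (w - c *: Q ^+ N) 0.
  by rewrite rootE hornerD hornerN hornerZ horner_exp divfK ?subrr // expf_neq0.
exists (r - c *: 'X^N), v.
rewrite comp_polyB rE comp_polyZ rmorphXn /= comp_polyX exprMn.
rewrite scalerAr exprSr -mulrA ['X * v]mulrC -['X]subr0 -polyC0 -[v * _]vE.
by rewrite polyC0 subr0 mulrBr addrA.
Qed.

Section Surjectivity.
Variables (n : nat) (L : zmodType) (e : lattice_basis n L) (a : nat -> rat).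
Hypothesis a1_neq0 : a 1%N != 0.

(** Congruence to an element of the image of [phi] modulo operators of order at least [N]. Such
    operators form a subalgebra, so it suffices to reach the variables. *)
Definition reached N (D : {mpoly rat[n]}) :=
  exists E : ShQ L, forall m, (mdeg m < N)%N -> D@_m = phi e a E m.

Lemma reachedD N D1 D2 : reached N D1 -> reached N D2 -> reached N (D1 + D2).
Proof.
move=> [E1 h1] [E2 h2]; exists (E1 + E2) => m ltm.
by rewrite mcoeffD h1 // h2 // linearD.
Qed.

Lemma reachedM N D1 D2 : reached N D1 -> reached N D2 -> reached N (D1 * D2).
Proof.
move=> [E1 h1] [E2 h2]; exists (E1 * E2) => m ltm.
by rewrite rmorphM; apply: mul_agree ltm.
Qed.

Lemma reached1 N : reached N 1.
Proof. by exists 1 => m _; rewrite rmorph1 mcoeff1. Qed.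

Lemma reachedZ N c D : reached N D -> reached N (c *: D).
Proof.
by move=> [E h]; exists (c *: E) => m ltm; rewrite mcoeffZ h // linearZ.
Qed.

Lemma reached_horner N D (r : {poly rat}) : reached N D -> reached N (horner_alg D r).
Proof.
move=> hD; elim/poly_ind: r => [|r c IH].
  by rewrite rmorph0 -(scale0r 1); apply/reachedZ/reached1.
rewrite rmorphD rmorphM /= horner_algX horner_algC.
by apply: reachedD; [apply: reachedM | apply/reachedZ/reached1].
Qed.

Lemma mcoeff_horner_algX (i : 'I_n) (r : {poly rat}) m :
  (horner_alg ('X_i : {mpoly rat[n]}) r)@_m =
  if m == (U_(i) *+ m i)%MM then r`_(m i) else 0.
Proof.
have -> : horner_alg ('X_i : {mpoly rat[n]}) r = \sum_(j < size r) r`_j *: 'X_i ^+ j.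
  rewrite -{1}[r]coefK poly_def raddf_sum; apply: eq_bigr => j _.
  by rewrite /= -mul_polyC rmorphM rmorphXn /= horner_algX horner_algC mulr_algl.
rewrite (raddf_sum (mcoeff m)) /=; case: eqP => [mE|nmE].
  have [ltm|lem] := ltnP (m i) (size r); last first.
    rewrite nth_default // big1 // => j _; rewrite mcoeffZ mcoeffXn.
    case: eqP => [jE|_]; last by rewrite mulr0.
    by move: (leq_trans (ltn_ord j) lem); rewrite -jE mulmnE mnm1E eqxx mul1n ltnn.
  rewrite (bigD1 (Ordinal ltm)) //= big1 => [|j /eqP/val_eqP /= nj].
    by rewrite mcoeffZ mcoeffXn -mE eqxx mulr1 addr0.
  rewrite mcoeffZ mcoeffXn; case: eqP => [jE|_]; last by rewrite mulr0.
  by case/eqP: nj; rewrite -jE mulmnE mnm1E eqxx mul1n.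
rewrite big1 // => j _; rewrite mcoeffZ mcoeffXn.
case: eqP => [jE|_]; last by rewrite mulr0.
by case: nmE; rewrite -jE mulmnE mnm1E eqxx mul1n.
Qed.

(** With [d] the derivative along [e i], the image of [T^{e_i}] is [p(d)]. Applying to [p(d) - 1] a
    polynomial inverse of [p(t) - 1] to order [N] gives [d] up to a multiple of [d^N]. *)
Lemma reached_var N (i : 'I_n) : reached N 'X_i.
Proof.
(* [Q] is [(p(t) - 1) / t] cut off. Taking [N.+1] terms keeps the constant term [a 1] even for
   [N = 0]. *)
pose Q := \poly_(j < N.+1) a j.+1.
have Q0 : Q.[0] != 0 by rewrite horner_coef0 coef_poly.
have [r [w rE]] := comp_poly_inverse N Q0.
have hP : reached N (horner_alg 'X_i (1 + 'X * Q)).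
  exists (translation rat (e i)) => m ltm; rewrite phi_basis mcoeff_horner_algX.
  rewrite /pseries; case: eqP => // mE; rewrite coefD coef1 coefXM coef_poly.
  have: (m i < N)%N by apply: leq_ltn_trans ltm; rewrite mdegE (bigD1 i) //= leq_addr.
  by case: (m i) => [|k] //= ltk; rewrite ?addr0 // add0r ltnS ltnW // ltnW.
have hQ : reached N (horner_alg 'X_i ('X * Q)).
  rewrite -[_ * _](addKr 1) rmorphD rmorphN rmorph1; apply: reachedD hP.
  by rewrite -scaleN1r; apply/reachedZ/reached1.
have [E hE] := reached_horner r hQ; exists E => m ltm; rewrite -hE //.
have -> : horner_alg (horner_alg ('X_i : {mpoly rat[n]}) ('X * Q)) r
    = 'X_i + 'X_i ^+ N * horner_alg 'X_i w.
  rewrite -[RHS](_ : horner_alg 'X_i (r \Po ('X * Q)) = _); last first.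
    by rewrite rE rmorphD rmorphM rmorphXn /= horner_algX.
  elim/poly_ind: (r) => [|r' c IH]; first by rewrite comp_poly0 !rmorph0.
  rewrite comp_poly_MXaddC !rmorphD [in RHS]rmorphM [in LHS]rmorphM /=.
  by rewrite horner_algX !horner_algC IH.
rewrite mcoeffD mpolyXn mulrC [X in _ + X]memN_msupp_eq0 ?addr0 //.
rewrite (perm_mem (msuppMX _ _)); apply/mapP => -[m' _ mE].
by move: ltm; rewrite mE mdegD mdegMn mdeg1 mul1n ltnNge leq_addr.
Qed.

Lemma reachedP N D : reached N D.
Proof.
elim/mpolyind: D => [|c m D _ _ IH];
  first by rewrite -(scale0r 1); apply/reachedZ/reached1.
apply: reachedD IH; apply: reachedZ; rewrite mpolyXE_id.
elim/big_ind: _ => [||i _]; [exact: reached1 | by move=> *; apply: reachedM|].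
elim: (m i) => [|k IHk]; first by rewrite expr0; apply: reached1.
by rewrite exprS; apply: reachedM => //; apply: reached_var.
Qed.

End Surjectivity.

(** * Taylor's formula *)

(* Coefficients of the exponential: by Taylor's formula [phi e expc] is the
   tautological action of shifts. *)
Definition expc (k : nat) : rat := (k`!)%:R^-1.

Lemma expc1_neq0 : expc 1 != 0.
Proof. by []. Qed.

Section Taylor.
Variables (n : nat).
Implicit Types (q : {mpoly rat[n]}) (s t : series n) (v w : 'I_n -> rat).

Definition acts_as_shift s w :=
  forall q v, (sact q s).@[v] = q.@[fun j => v j + w j].

(** Restricting [q] to the line through [v] in direction [i] turns derivatives along that direction
    into ordinary ones. The claim becomes the one-variable Taylor formula with increment 1. *)
Lemma pseries_exp_shift i : acts_as_shift (pseries expc i) (fun j => (j == i)%:R).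
Proof.
move=> q v; pose l := line_poly i v q; pose k := maxn (msize q) (size l).
have lD j : l^`(j) = line_poly i v q^`M[U_(i) *+ j].
  elim: j => [|j IH]; first by rewrite mulm0n mderivm0m.
  rewrite derivnS IH line_poly_deriv; congr line_poly.
  by rewrite mulmS addmC mderivmDm mderivmU1m.
have -> : q.@[fun j => v j + (j == i)%:R] = l.[0 + 1].
  by rewrite add0r line_polyE; apply: meval_eq => j; rewrite mulr1.
rewrite (@nderiv_taylor_wide _ k) ?leq_maxr //.
rewrite -(@mdiff_sact _ (horner_alg 'X_i (\poly_(j < k) expc j))); last first.
  move=> m ltm; rewrite mcoeff_horner_algX /pseries; case: eqP => // mE.
  rewrite coef_poly leq_max (leq_ltn_trans _ ltm) /=; first by case: (m i).
  by rewrite mdegE (bigD1 i) //= leq_addr.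
have -> : mdiff (horner_alg 'X_i (\poly_(j < k) expc j)) q
    = \sum_(j < k) expc j *: q^`M[U_(i) *+ j].
  rewrite poly_def raddf_sum (big_morph _ (fun A B => mdiffDl A B q) (mdiff0l q)).
  apply: eq_bigr => j _ /=.
  rewrite -mul_polyC rmorphM rmorphXn /= horner_algX horner_algC mulr_algl.
  by rewrite mdiffZl mpolyXn mdiffX.
rewrite raddf_sum; apply: eq_bigr => j _; rewrite /= mevalZ expr1n mulr1.
have := congr1 (fun p : {poly rat} => p.[0]) (lD j).
rewrite nderivn_def hornerMn line_polyE => lj.
have vE : (fun l' => v l' + (l' == i)%:R * 0) = v.
  by apply: funext => l'; rewrite mulr0 addr0.
by rewrite vE in lj; rewrite -lj -mulr_natl /expc mulKf // pnatr_eq0 -lt0n fact_gt0.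
Qed.

Lemma shift1 : acts_as_shift 1 (fun=> 0).
Proof. by move=> q v; rewrite sact1; apply: meval_eq => j; rewrite addr0. Qed.

Lemma shiftM s t v w : acts_as_shift s v -> acts_as_shift t w ->
  acts_as_shift (s * t) (fun j => v j + w j).
Proof.
move=> hs ht q x; rewrite sactM hs ht; apply: meval_eq => j.
by rewrite addrA.
Qed.

(** The hypothesis on [s] is applied to [sact q s^-1], which [s] carries back to [q]. *)
Lemma shiftV s w : s \is a GRing.unit -> acts_as_shift s w ->
  acts_as_shift s^-1 (fun j => - w j).
Proof.
move=> us hs q v; have := hs (sact q s^-1) (fun j => v j - w j).
rewrite -sactM divrr // sact1 => ->; apply: meval_eq => j.
by rewrite subrK.
Qed.

Lemma shiftX s w k : acts_as_shift s w -> acts_as_shift (s ^+ k) (fun j => k%:R * w j).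
Proof.
move=> hs; elim: k => [|k IH].
  rewrite expr0 => q v; rewrite shift1; apply: meval_eq => j.
  by rewrite mul0r.
rewrite exprS => q v; rewrite (shiftM hs IH); apply: meval_eq => j.
by rewrite -natr1; ring.
Qed.

Lemma shiftXz s w (k : int) : s \is a GRing.unit -> acts_as_shift s w ->
  acts_as_shift (s ^ k) (fun j => k%:~R * w j).
Proof.
move=> us hs; case: k => k; first exact: shiftX.
rewrite NegzE -invr_expz => q v; rewrite (shiftV _ (shiftX k.+1 hs)) ?unitrX //.
by apply: meval_eq => j; rewrite rmorphN mulNr.
Qed.

Lemma shift_prod (I : Type) (r : seq I) (s : I -> series n) (w : I -> 'I_n -> rat) :
  (forall i, acts_as_shift (s i) (w i)) ->
  acts_as_shift (\prod_(i <- r) s i) (fun j => \sum_(i <- r) w i j).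
Proof.
move=> h; elim: r => [|i r IH] q v.
  by rewrite big_nil shift1; apply: meval_eq => j; rewrite big_nil.
by rewrite big_cons (shiftM (h i) IH); apply: meval_eq => j; rewrite big_cons.
Qed.

End Taylor.

(** * Shifts on the lattice as series, and clearing denominators *)

Section Lattice.
Variables (n : nat) (L : zmodType) (e : lattice_basis n L).

Lemma phi_exp_shift (u : L) :
  acts_as_shift (phi e expc (translation rat u)) (qcoord e u).
Proof.
rewrite /phi grp_liftU scale1r => q v.
have h i := shiftXz (Defs.coord e u i) (pseries_unit expc i) (pseries_exp_shift i).
rewrite (shift_prod _ h); apply: meval_eq => j; congr (_ + _).
rewrite (bigD1 j) //= eqxx mulr1 big1 ?addr0 // => i /negPf nij.
by rewrite eq_sym nij mulr0.
Qed.

Lemma sact_phi_sum a q (r : seq L) (c : L -> rat) :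
  sact q (phi e a (\sum_(u <- r) << c u *g u >>))
  = \sum_(u <- r) c u *: sact q (phi e a (translation rat u)).
Proof.
rewrite (linear_sum (phi e a)) (linear_sum (sact q)); apply: eq_bigr => u _.
by rewrite -(linearZ_LR (sact q)) -(linearZ_LR (phi e a)) scale_grpU mulr1.
Qed.

Lemma qcoordD u v i : qcoord e (u + v) i = qcoord e u i + qcoord e v i.
Proof. by rewrite /qcoord Defs.coordD ffunE rmorphD. Qed.

(** This places shifts and derivatives in one commutative algebra of series, where their
    annihilators can be compared. *)
Lemma sh_act_exp (E : Sh L) (f : polyfun e) x :
  sh_act E f x = (sact (pf_rep f) (phi e expc (ShQ_of_Sh E))).@[qcoord e x].
Proof.
rewrite /ShQ_of_Sh sact_phi_sum raddf_sum; apply: eq_bigr => u _ /=.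
rewrite mevalZ phi_exp_shift pf_repP; congr (_ * _).
by apply: meval_eq => j; rewrite qcoordD.
Qed.

Lemma eval_lattice_eq0 (q : {mpoly rat[n]}) :
  (forall x, q.@[qcoord e x] = 0) -> q = 0.
Proof.
move=> q0; rewrite -[q](polyfun_ofK e) -[RHS](polyfun_ofK e); congr pf_rep.
by apply: polyfun_eq => x; rewrite /= q0 meval0.
Qed.

Lemma ann_ShP (E : Sh L) (f : polyfun e) :
  (E \in ideal_mem (ann_Sh f)) <-> sact (pf_rep f) (phi e expc (ShQ_of_Sh E)) = 0.
Proof.
split=> [/asboolP E0|E0]; first by apply: eval_lattice_eq0 => x; rewrite -sh_act_exp.
by apply/asboolP => x; rewrite sh_act_exp E0 meval0.
Qed.

Lemma ShQ_of_ShE (E : Sh L) :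
  ShQ_of_Sh E = grp_lift (fun u => translation rat u : zmodule (ShQ L)) E.
Proof.
by apply: eq_bigr => u _; rewrite [RHS]scalezrE /translation freeg_mulz.
Qed.

Lemma ShQ_clear_denom (E : ShQ L) :
  exists (N : int) (E0 : Sh L), N != 0 /\ ShQ_of_Sh E0 = N%:~R *: E.
Proof.
elim/grp_ind: E => [|b u|E1 E2 [N1 [D1 [n1 h1]]] [N2 [D2 [n2 h2]]]].
- exists 1, 0; split=> //; rewrite ShQ_of_ShE linear0 scaler0 //.
- exists (denq b), << numq b *g u >>; split; first exact: denq_neq0.
  rewrite ShQ_of_ShE grp_liftU scale_grpU mulrC -numqE.
  by rewrite scalezrE /translation freeg_mulz.
- exists (N1 * N2), (D1 *~ N2 + D2 *~ N1); split; first exact: mulf_neq0.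
  rewrite ShQ_of_ShE raddfD !raddfMz /= -!ShQ_of_ShE h1 h2 scalerDr.
  rewrite -(scaler_int N2 (_ *: E1)) -(scaler_int N1 (_ *: E2)) !scalerA -!intrM.
  by rewrite [N2 * N1]mulrC.
Qed.

Lemma DiffQ_clear_denom (D : DiffQ n) :
  exists (N : int) (D0 : Diff n), N != 0 /\ DiffQ_of_Diff D0 = N%:~R *: D.
Proof.
rewrite /DiffQ_of_Diff.
elim/mpolyind: D => [|b m D _ _ [N [D0 [nz h]]]].
  by exists 1, 0; split=> //; rewrite raddf0 scaler0.
exists (denq b * N), ((numq b * N) *: 'X_[m] + denq b *: D0).
split; first by rewrite mulf_neq0 ?denq_neq0.
rewrite raddfD /= !map_mpolyZ /= map_mpolyX h scalerDr !scalerA.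
rewrite !intrM; congr (_ *: _ + _).
by rewrite -{3}[b]divq_num_den; field; rewrite intr_eq0 denq_neq0.
Qed.

End Lattice.

(** * Macaulay duality *)

Section Duality.
Variable n : nat.
Implicit Types (D p q r : {mpoly rat[n]}) (m : 'X_{1..n}).

Lemma mderivm_at0_eq0 p : (forall m, (p^`M[m])@_0 = 0) -> p = 0.
Proof.
move=> p0; apply/mpolyP => m; rewrite mcoeff0.
have := p0 m; rewrite mcoeff_mderivm addm0 => /eqP; rewrite mulrn_eq0.
case/orP => [|/eqP //]; rewrite -leqn0 leqNgt prodn_gt0 // => i.
by rewrite ffact_gt0.
Qed.

Lemma mdiffC D E q : mdiff D (mdiff E q) = mdiff E (mdiff D q).
Proof. by rewrite -!mdiffM mulrC. Qed.

Lemma mdiff_sum (I : finType) (c : I -> rat) (m : I -> 'X_{1..n}) q :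
  mdiff (\sum_i c i *: 'X_[m i]) q = \sum_i c i *: q^`M[m i].
Proof.
rewrite (big_morph _ (fun A B => mdiffDl A B q) (mdiff0l q)).
by apply: eq_bigr => i _; rewrite mdiffZl mdiffX.
Qed.

(* Macaulay duality: the row of Taylor coefficients of [r] is killed by the
   kernel of the symmetric catalecticant matrix [G] of [q], hence is a
   combination of the rows of [G]. *)
Lemma macaulay_duality q r : (forall D, mdiff D q = 0 -> mdiff D r = 0) ->
  exists D, r = mdiff D q.
Proof.
move=> ann; pose k := maxn (msize q) (msize r).
pose I := 'X_{1..n < k} : finType; pose m (i : 'I_#|I|) : 'X_{1..n} := val (enum_val i).
pose G : 'M[rat]_#|I| := \matrix_(i, j) (q^`M[m i + m j])@_0.
pose H : 'rV[rat]_#|I| := \row_j (r^`M[m j])@_0.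
(* Derivatives of order at least [k] vanish anyway, so the finitely many Taylor coefficients indexed
   by [I] decide whether [mdiff D p] is zero. *)
have big p : (msize p <= k)%N -> forall D, (forall j, ((mdiff D p)^`M[m j])@_0 = 0) ->
    mdiff D p = 0.
  move=> lepk D h; apply: mderivm_at0_eq0 => m'.
  have [lt|le] := ltnP (mdeg m') k.
    by have := h (enum_rank (BMultinom lt : I)); rewrite /m enum_rankK.
  rewrite -mdiffX mdiffC mdiffX mderivm_eq0 ?linear0 ?mcoeff0 //.
  exact: leq_trans le.
have /submxP [C HC] : (H <= G)%MS.
  rewrite submxE; apply/eqP/rowP => l; rewrite !mxE.
  (* A column of the cokernel is read as an operator [D]. Its product with [G] lists Taylor
     coefficients of [mdiff D q], and its product with [H] is the value of [mdiff D r] at 0. *)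
  pose D := \sum_i cokermx G i l *: 'X_[m i].
  have Dq : mdiff D q = 0.
    apply: big => [|j]; first exact: leq_maxl.
    have /matrixP/(_ j l) := mulmx_coker G; rewrite !mxE => <-.
    rewrite mdiff_sum (raddf_sum (mderivm (m j))) (raddf_sum (mcoeff 0)).
    apply: eq_bigr => i _.
    by rewrite /= mderivmZ mcoeffZ -mderivmDm addmC !mxE mulrC.
  have /(congr1 (mcoeff 0)) := ann _ Dq; rewrite mdiff_sum raddf_sum /= mcoeff0 => Dr.
  by rewrite -[RHS]Dr; apply: eq_bigr => i _; rewrite mcoeffZ !mxE mulrC.
exists (\sum_j C 0 j *: 'X_[m j]).
apply/eqP; rewrite -subr_eq0; apply/eqP; apply: mderivm_at0_eq0 => m'.
rewrite mderivmB mcoeffB; apply/eqP; rewrite subr_eq0; apply/eqP.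
have [lt|le] := ltnP (mdeg m') k; last first.
  rewrite -[in RHS]mdiffX mdiffC mdiffX !mderivm_eq0 ?linear0 //;
    by apply: leq_trans le; rewrite ?leq_maxr ?leq_maxl.
pose i := enum_rank (BMultinom lt : I).
have -> : m' = m i by rewrite /m enum_rankK.
have := congr1 (fun A : 'rV_#|I| => A 0 i) HC; rewrite !mxE => ->.
rewrite mdiff_sum (raddf_sum (mderivm (m i))) (raddf_sum (mcoeff 0)).
by apply: eq_bigr => j _; rewrite /= mderivmZ mcoeffZ -mderivmDm !mxE.
Qed.

Lemma mdiff_sactC D q s : mdiff D (sact q s) = sact (mdiff D q) s.
Proof.
pose k := maxn (msize q) (msize (mdiff D q)).
by rewrite -!(@series_trunc_act _ k) ?leq_maxl ?leq_maxr // mdiffC.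
Qed.

End Duality.

(** * Rational annihilators and the map [Psi] *)

Lemma grpring_scalerAl (R : comNzRingType) (L : zmodType) c (D E : grpring R L) :
  (c *: D) * E = c *: (D * E).
Proof. by rewrite [LHS]grpring_mulE linearZ /= -grpring_mulE. Qed.

Section Operators.
Variables (n : nat) (L : zmodType) (e : lattice_basis n L).
Implicit Types (f g h : polyfun e) (E : ShQ L) (D : DiffQ n).

Lemma polyfun_of_inj : injective (polyfun_of e).
Proof. exact: can_inj (polyfun_ofK e). Qed.

Lemma qcoord0 : qcoord e 0 = (fun=> 0).
Proof. by apply: funext => i; rewrite /qcoord Defs.coord0 ffunE. Qed.

(** A nonzero integer multiple of [E] comes from [Sh L], so the ideal generated by the integral
    annihilator is the whole rational annihilator. *)
Lemma extend_ann_ShP f E :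
  E \in ideal_mem (extend_ideal (@ShQ_of_Sh L) (ann_Sh f)) <->
  sact (pf_rep f) (phi e expc E) = 0.
Proof.
split=> [/asboolP [s [hs ->]]|F0].
  rewrite (linear_sum (phi e expc)) (linear_sum (sact _)) big_seq big1 // => cy.
  move=> /(allP hs) /ann_ShP cy0.
  by rewrite rmorphM /= sactM cy0 sact0r.
have [N [E0 [nz h]]] := ShQ_clear_denom E.
apply/asboolP; exists [:: ((N%:~R : rat)^-1 *: (1 : ShQ L), E0)]; split.
  by rewrite /= andbT; apply/ann_ShP; rewrite h !linearZ /= F0 scaler0.
by rewrite big_seq1 /= h grpring_scalerAl mul1r scalerA mulVf ?scale1r // intr_eq0.
Qed.

Lemma ann_DiffP (D : Diff n) h :
  (D \in ideal_mem (ann_Diff h)) <-> mdiff (DiffQ_of_Diff D) (pf_rep h) = 0.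
Proof.
split=> [/asboolP|D0]; first by move/diff_act_eq0.
by apply/asboolP/diff_act_eq0.
Qed.

Lemma extend_ann_DiffP g D :
  D \in ideal_mem (extend_ideal (@DiffQ_of_Diff n) (ann_Diff g)) <->
  mdiff D (pf_rep g) = 0.
Proof.
split=> [|D0]; first exact: extend_ann_Diff.
have [N [E0 [nz h]]] := DiffQ_clear_denom D.
apply/asboolP; exists [:: ((N%:~R : rat)^-1 *: (1 : DiffQ n), E0)]; split.
  by rewrite /= andbT; apply/ann_DiffP; rewrite h mdiffZl D0 scaler0.
by rewrite big_seq1 /= h -scalerAl mul1r scalerA mulVf ?scale1r // intr_eq0.
Qed.

Lemma diff_equivP f h : differentially_equivalent f h <->
  forall D, mdiff D (pf_rep f) = 0 <-> mdiff D (pf_rep h) = 0.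
Proof.
split=> [fh D|fh D]; last first.
  by apply/idP/idP => /ann_DiffP/fh/ann_DiffP.
have [N [D0 [nz hD]]] := DiffQ_clear_denom D.
have nzN : N%:~R != 0 :> rat by rewrite intr_eq0.
have eqv h' : mdiff D (pf_rep h') = 0 <-> D0 \in ideal_mem (ann_Diff h').
  split=> [h0|/ann_DiffP]; first by apply/ann_DiffP; rewrite hD mdiffZl h0 scaler0.
  by rewrite hD mdiffZl => /eqP; rewrite scaler_eq0 (negPf nzN) => /eqP.
by split=> /eqv; [rewrite fh | rewrite -fh] => /eqv.
Qed.

Lemma reached_mdiff a N D : a 1%N != 0 ->
  exists E, forall q, (msize q <= N)%N -> mdiff D q = sact q (phi e a E).
Proof.
move=> a1; have [E hE] := reachedP e a1 N D.
by exists E => q leq; apply: mdiff_sact => m ltm; apply/hE/(leq_trans ltm).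
Qed.

(** On polynomials of size at most [k], every [phi e expc E] acts as its truncation, and conversely
    every differential operator acts as some [phi e expc E]. *)
Lemma diff_equiv_ShP f h : differentially_equivalent f h <->
  forall E, sact (pf_rep f) (phi e expc E) = 0 <-> sact (pf_rep h) (phi e expc E) = 0.
Proof.
pose k := maxn (msize (pf_rep f)) (msize (pf_rep h)).
have lf : (msize (pf_rep f) <= k)%N by apply: leq_maxl.
have lh : (msize (pf_rep h) <= k)%N by apply: leq_maxr.
split=> [/diff_equivP fh E|fh]; last apply/diff_equivP => D.
  by rewrite -!(@series_trunc_act _ k).
have [E hE] := reached_mdiff k D expc1_neq0.
by rewrite !hE.
Qed.

Lemma PsiE a h u :
  Psi a h u = (sact (pf_rep h) (phi e a (translation rat u))).@[qcoord e 0].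
Proof. by []. Qed.

Lemma sactAC q (s t : series n) : sact (sact q s) t = sact (sact q t) s.
Proof. by rewrite -!sactM mulrC. Qed.

Lemma sact_phiE a q E : sact q (phi e a E)
  = \sum_(v <- dom E) coeff v E *: sact q (phi e a (translation rat v)).
Proof. by rewrite -sact_phi_sum; congr (sact q (phi e a _)); rewrite freeg_sumE. Qed.

(** Since [phi] is multiplicative, [T^u T^v = T^(u+v)] makes both sides at [u] equal to the
    combination of the values [Psi a h (u + v)] with the coefficients of [E]. *)
Lemma Psi_shift a h E :
  polyfun_of e (sact (pf_rep (Psi a h)) (phi e expc E))
  = Psi a (polyfun_of e (sact (pf_rep h) (phi e a E))).
Proof.
apply: polyfun_eq => u; rewrite PsiE polyfun_ofK sactAC /=.
rewrite !(sact_phiE _ _ E) !(raddf_sum (meval _)).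
apply: eq_bigr => v _; rewrite /= !mevalZ phi_exp_shift -sactM -rmorphM -translationD.
congr (_ * _); rewrite addrC -PsiE [RHS]pf_repP; apply: meval_eq => j.
by rewrite -qcoordD addrC.
Qed.

(** By surjectivity to finite order, each derivative of [h] at 0 is a linear combination of values
    of [Psi a h]; hence all Taylor coefficients of [h] vanish. *)
Lemma Psi_eq0 a h : a 1%N != 0 -> (forall u, Psi a h u = 0) -> pf_rep h = 0.
Proof.
move=> a1 h0; apply: mderivm_at0_eq0 => m.
have [E hE] := reached_mdiff (msize (pf_rep h)) 'X_[m] a1.
rewrite -mdiffX hE // -meval_at0 -qcoord0 sact_phiE raddf_sum big1 //= => u _.
by rewrite mevalZ -PsiE h0 mulr0.
Qed.

Lemma ann_Psi a h E : a 1%N != 0 ->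
  sact (pf_rep (Psi a h)) (phi e expc E) = 0 <-> sact (pf_rep h) (phi e a E) = 0.
Proof.
move=> a1; have PE := Psi_shift a h E; split=> E0.
  rewrite -[LHS](polyfun_ofK e); apply: (Psi_eq0 a1) => u.
  by rewrite -PE E0 /= meval0.
apply: polyfun_of_inj; rewrite PE E0; apply: polyfun_eq => u.
by rewrite PsiE polyfun_ofK sact0r /= !meval0.
Qed.

(** * The algebra [QA g] seen through its action on [g] *)

Section Quotient.
Variables (a : nat -> rat) (g : polyfun e).
Implicit Types x y : QA g.

(** Identifies [QA g] with a space of derivatives of [g], so equations in the quotient can be
    checked on polynomials. *)
Lemma QA_act_inj : injective (@QA_act n L e g).
Proof.
move=> x y; rewrite -[x]quot_reprK -[y]quot_reprK !QA_act_class.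
move=> /polyfun_of_inj xy; apply/quot_projP/extend_ann_DiffP.
by rewrite mdiffDl -scaleN1r mdiffZl scaleN1r xy subrr.
Qed.

Lemma QA_act_mul x y : QA_act (x * y) = diffQ_act (quot_repr x) (QA_act y).
Proof.
have -> : x * y = QA_class g (quot_repr x * quot_repr y) by [].
by rewrite QA_act_class diffQ_actM.
Qed.

Lemma QA_act0 : QA_act (0 : QA g) = polyfun_of e 0.
Proof. by rewrite -(raddf0 (@quot_proj _ _)) QA_act_class /diffQ_act mdiff0l. Qed.

Lemma QA_act1 : QA_act (1 : QA g) = g.
Proof. by rewrite QA_act_class /diffQ_act mdiff1 pf_repK. Qed.

Lemma QA_act_phi E :
  QA_act (phi_QA a g E) = polyfun_of e (sact (pf_rep g) (phi e a E)).
Proof. exact: QA_act_series. Qed.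

Lemma QA_act_mul_phi x E :
  QA_act (x * phi_QA a g E) = polyfun_of e (sact (pf_rep (QA_act x)) (phi e a E)).
Proof.
by rewrite QA_act_mul QA_act_phi /diffQ_act !polyfun_ofK mdiff_sactC.
Qed.

Lemma mul_phi_QA_eq0 x E :
  x * phi_QA a g E = 0 <-> sact (pf_rep (QA_act x)) (phi e a E) = 0.
Proof.
split=> [/(congr1 (@QA_act n L e g))|s0]; last apply: QA_act_inj.
  by rewrite QA_act_mul_phi QA_act0 => /polyfun_of_inj.
by rewrite QA_act_mul_phi QA_act0 s0.
Qed.

Lemma phi_QA_eq0 E : phi_QA a g E = 0 <-> sact (pf_rep g) (phi e a E) = 0.
Proof. by have := mul_phi_QA_eq0 1 E; rewrite QA_act1 mul1r. Qed.

Lemma phi_QA_zmod_morphism : zmod_morphism (phi_QA (e := e) a g).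
Proof.
move=> E1 E2; rewrite /phi_QA /QA_of_series /QA_class -raddfB; congr quot_proj.
rewrite -sumrB linearB; apply: eq_bigr => m _.
by rewrite -scalerBl.
Qed.

(** Truncation of series is not multiplicative; multiplicativity holds after acting on [g], where it
    is [sactM]. *)
Lemma phi_QA_monoid_morphism : monoid_morphism (phi_QA (e := e) a g).
Proof.
split=> [|E1 E2]; apply: QA_act_inj.
  by rewrite QA_act_phi QA_act1 rmorph1 sact1 pf_repK.
by rewrite QA_act_mul_phi !QA_act_phi polyfun_ofK rmorphM mulrC sactM.
Qed.

Lemma phi_QA_surj x : a 1%N != 0 -> exists E, phi_QA a g E = x.
Proof.
move=> a1; have [E hE] := reached_mdiff (msize (pf_rep g)) (quot_repr x) a1.
by exists E; apply: QA_act_inj; rewrite QA_act_phi -hE.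
Qed.

End Quotient.
End Operators.

(** * The four conditions and the common kernel *)

Section Equivalence.
Variables (n : nat) (L : zmodType) (e : lattice_basis n L) (a : nat -> rat).
Hypothesis a1_neq0 : a 1%N != 0.
Variables f g : polyfun e.

(* The kernel of [ShQ L -> QA g] is the rational annihilator of [f]. *)
Definition same_kernel := forall E : ShQ L,
  sact (pf_rep f) (phi e expc E) = 0 <-> sact (pf_rep g) (phi e a E) = 0.

Lemma diff_equiv_Psi : differentially_equivalent f (Psi a g) <-> same_kernel.
Proof.
split=> [/diff_equiv_ShP fg E|fg]; last apply/diff_equiv_ShP => E.
  by rewrite fg ann_Psi.
by rewrite fg ann_Psi.
Qed.

Lemma QK_class_eq0 E : QK_class f E = 0 <-> sact (pf_rep f) (phi e expc E) = 0.
Proof.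
rewrite -extend_ann_ShP -[E in _ <-> E \in _]subr0 -quot_projP.
by rewrite (raddf0 (@quot_proj _ _)).
Qed.

(** One inclusion of kernels makes the map on representatives well defined, the other makes it
    injective. Surjectivity comes from [a 1 != 0]. *)
Lemma iso_same_kernel : same_kernel <->
  exists phibar : {rmorphism QK f -> QA g},
    (forall E : ShQ L, phibar (QK_class f E) = phi_QA a g E) /\ bijective phibar.
Proof.
split=> [ker|[phibar [phiE bij]] E]; last first.
  rewrite -QK_class_eq0 -phi_QA_eq0 -phiE.
  by split=> [->|]; rewrite -(rmorph0 phibar); [|apply: bij_inj].
pose F (x : QK f) := phi_QA a g (quot_repr x).
have FE E : F (QK_class f E) = phi_QA a g E.
  apply/eqP; rewrite -subr_eq0 -phi_QA_zmod_morphism; apply/eqP.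
  by apply/phi_QA_eq0/ker/extend_ann_ShP/quot_repr_proj.
have FB : zmod_morphism F.
  move=> x y; rewrite -[x]quot_reprK -[y]quot_reprK -raddfB.
  by rewrite !FE phi_QA_zmod_morphism.
have FM : monoid_morphism F.
  have [p1 pM] := phi_QA_monoid_morphism a g.
  split=> [|x y]; first by rewrite -p1 -FE.
  by rewrite -[x]quot_reprK -[y]quot_reprK -rmorphM !FE pM.
pose phibar : {rmorphism QK f -> QA g} :=
  HB.pack F (GRing.isZmodMorphism.Build _ _ F FB) (GRing.isMonoidMorphism.Build _ _ F FM).
exists phibar; split=> //.
pose inv (y : QA g) := QK_class f (projT1 (cid (phi_QA_surj y a1_neq0))).
have invK : cancel inv F by move=> y; rewrite /inv FE; case: cid.
have F_inj : injective F.
  move=> x y xy; apply/eqP; rewrite -subr_eq0; apply/eqP.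
  have : F (x - y) = 0 by rewrite FB xy subrr.
  by move/phi_QA_eq0/ker/QK_class_eq0; rewrite /QK_class quot_reprK.
by exists inv => // x; apply: F_inj; rewrite invK.
Qed.

(** Multiplying by the unit [td] does not change which [phi_QA a g E] vanish. *)
Lemma Psi_td_same_kernel (td : QA g) : is_invertible td -> f = Psi a (QA_act td) ->
  same_kernel.
Proof.
move=> [td' td'K] fE E; rewrite fE ann_Psi // -mul_phi_QA_eq0 -phi_QA_eq0.
split=> [|->]; last exact: mulr0.
by move/(congr1 ( *%R td')); rewrite mulrA (mulrC td') td'K mul1r mulr0.
Qed.

(** By duality [f] and [Psi a g] are derivatives of each other, hence related by shift operators [E]
    and [E']. Moving [E] through [Psi] gives [td = phi_QA a g E], with inverse [phi_QA a g E']. *)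
Lemma same_kernel_Psi_td : same_kernel ->
  exists td : QA g, is_invertible td /\ f = Psi a (QA_act td).
Proof.
move=> /diff_equiv_Psi/diff_equivP ann.
have [D fD] := macaulay_duality (fun D => (ann D).2).
have [D' PD] := macaulay_duality (fun D => (ann D).1).
have [E hE] := reached_mdiff e (msize (pf_rep (Psi a g))) D expc1_neq0.
have [E' hE'] := reached_mdiff e (msize (pf_rep f)) D' expc1_neq0.
rewrite {}hE // in fD; rewrite {}hE' // in PD.
have fE : f = Psi a (QA_act (phi_QA a g E)).
  by rewrite QA_act_phi -Psi_shift -fD pf_repK.
exists (phi_QA a g E); split=> //; exists (phi_QA a g E').
have [p1 pM] := phi_QA_monoid_morphism a g.
apply/eqP; rewrite -subr_eq0 -pM -p1 -phi_QA_zmod_morphism; apply/eqP/phi_QA_eq0.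
(* The claim that [E * E' - 1] kills [g] through [phi e a] is transported to [Psi a g], where [E]
   leads to [f] and [E'] leads back. *)
apply/ann_Psi => //; rewrite rmorphB rmorphM rmorph1 linearB /= sact1.
by rewrite mulrC sactM -fD -PD subrr.
Qed.

(** Both sides are additive in [E], and for [E = T^u] the identity is the desired equality at the
    point [u]. *)
Lemma chi_td (td : QA g) :
  (forall E : Sh L, chi f E = QA_deg (td * phi_QA a g (ShQ_of_Sh E))) <->
  f = Psi a (QA_act td).
Proof.
have degE E : QA_deg (td * phi_QA a g E)
    = (sact (pf_rep (QA_act td)) (phi e a E)).@[qcoord e 0].
  by rewrite /QA_deg QA_act_mul_phi.
split=> [chiE|fE E].
  apply: polyfun_eq => u; have := chiE (translation int u).
  by rewrite /chi sh_act_translation add0r degE ShQ_of_ShE grp_liftU scale1r.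
rewrite degE /ShQ_of_Sh sact_phi_sum raddf_sum; apply: eq_bigr => u _ /=.
by rewrite mevalZ add0r {1}fE PsiE.
Qed.

End Equivalence.

Theorem theorem3p39 (n : nat) (L : zmodType) (e : lattice_basis n L)
    (a : nat -> rat) (a1_neq0 : a 1%N != 0) (f g : polyfun e) :
  [<->
    exists phibar : {rmorphism QK f -> QA g},
      (forall E : ShQ L, phibar (QK_class f E) = phi_QA a g E) /\
      bijective phibar;
    exists td : QA g, is_invertible td /\
      forall E : Sh L, chi f E = QA_deg (td * phi_QA a g (ShQ_of_Sh E));
    exists td : QA g, is_invertible td /\ f = Psi a (QA_act td);
    differentially_equivalent f (Psi a g) ].
Proof.
do ![split] => [|||].
- case/iso_same_kernel/same_kernel_Psi_td=> // td [td_inv fE].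
  by exists td; split=> //; apply/chi_td.
- by case=> td [td_inv /chi_td fE]; exists td.
- by case=> td [td_inv fE]; apply/diff_equiv_Psi/(Psi_td_same_kernel _ td_inv).
- by move/diff_equiv_Psi => ker; apply/iso_same_kernel/ker.
Qed.
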